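(* Let $\mu$ be a good measure on $[0,\infty)^{\mathrm{Edges}(\mathbb{Z}^2)}$ and let $k\le\mathrm{Sides}(\mu)$ be a positive integer. Then for every $\epsilon>0$ there exist $x_1,\dots,x_k\in\mathbb{Z}^2$ such that $$\mathbf{P}\big(C(x_1,\dots,x_k)\big)>1-\epsilon .$$
   Context: $\mathrm{Edges}(\mathbb{Z}^2)$ is the set of nearest-neighbour edges of $\mathbb{Z}^2$; $\mu$ is a probability measure on $[0,\infty)^{\mathrm{Edges}(\mathbb{Z}^2)}$, $\omega$ is a realization of $\mu$, and $\mathbf{P}$ is the corresponding probability. For $x,y\in\mathbb{Z}^2$ the passage time is $\tau(x,y)=\inf\sum\omega(v_i,v_{i+1})$, where the sum is over the edges of a nearest-neighbour path and the infimum is over all finite paths from $x$ to $y$. It is extended to $\mathbb{R}^2\times\mathbb{R}^2$ by $\tau(x+u,y+u')=\tau(x,y)$ for $x,y\in\mathbb{Z}^2$, $u,u'\in[-\frac12,\frac12)^2$. Limit shape: let $R(t)=\{v\in\mathbb{R}^2:\tau(\mathbf 0,v)\le t\}$. For stationary ergodic $\mu$ whose edge marginals have finite $2+\epsilon$ moment for some $\epsilon>0$, the shape theorem gives a closed, nonempty, convex set $R\subset\mathbb{R}^2$, symmetric about the coordinate axes, such that for every $\epsilon>0$, almost surely $(1-\epsilon)R\subset R(t)/t\subset(1+\epsilon)R$ for all sufficiently large $t$. $\mu$ is good if: (1) $\mu$ is ergodic (with respect to the translations of $\mathbb{Z}^2$); (2) $\mu$ has all the symmetries of $\mathbb{Z}^2$;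 (3) $\mu$ has unique passage times, i.e. $\mathbf{P}(\tau(x,y)\ne\tau(x,z))=1$ for all $x,y,z\in\mathbb{Z}^2$ with $y\neq z$; (4) the distribution of $\mu$ on any edge has finite $2+\epsilon$ moment for some $\epsilon>0$; (5) $R$ is bounded. $\mathrm{Sides}(\mu)$ is the number of sides of $\partial R$ if $\partial R$ is a polygon, and $\infty$ otherwise. Growth model: for $x_1,\dots,x_k\in\mathbb{Z}^2$, $z\in\mathbb{Z}^2$ and $t\ge0$ put $\tilde\omega_{x_1,\dots,x_k}(z,t)=i$ if $\tau(x_i,z)\le t$ and $\tau(x_i,z)<\tau(x_j,z)$ for all $j\ne i$, and $\tilde\omega_{x_1,\dots,x_k}(z,t)=0$ if there is no such $i$. Let $\tilde\omega_{x_1,\dots,x_k}(z)=\lim_{t\to\infty}\tilde\omega_{x_1,\dots,x_k}(z,t)$. Coexistence (mutual unbounded growth) $C(x_1,\dots,x_k)$ is the event that for every $i\in\{1,\dots,k\}$ the set $\{z\in\mathbb{Z}^2:\tilde\omega_{x_1,\dots,x_k}(z)=i\}$ is infinite. *)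

(* Defs.v *)
From HB Require Import structures.
From mathcomp Require Import all_boot all_order all_algebra.
From mathcomp Require Import finmap.
From mathcomp Require Import all_classical all_reals all_analysis.

Set Implicit Arguments.
Unset Strict Implicit.
Unset Printing Implicit Defensive.

Import Order.TTheory GRing.Theory Num.Theory.
Import numFieldNormedType.Exports.

Local Open Scope classical_set_scope.
Local Open Scope ring_scope.

Notation Z2 := (int * int)%type.

Definition nn_adjacent (x y : Z2) : bool :=
  `|x.1 - y.1| + `|x.2 - y.2| == 1.

(* [(x, true)] is the undirected edge {x, x + (1, 0)} and [(x, false)] is the
   undirected edge {x, x + (0, 1)}; each edge of Z^2 has exactly one code. *)
Definition edge : Type := (Z2 * bool)%type.

Definition edge_src (e : edge) : Z2 := e.1.
Definition edge_tgt (e : edge) : Z2 := e.1 + (if e.2 then (1, 0) else (0, 1)).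

(* The edge {x, y}; meaningful only when [nn_adjacent x y]. *)
Definition edge_of (x y : Z2) : edge :=
  ((Num.min x.1 y.1, Num.min x.2 y.2), x.2 == y.2).

Section Configurations.
Variable R : realType.

Definition config : Type := edge -> {nonneg R}.

HB.instance Definition _ := Choice.on config.
HB.instance Definition _ := isPointed.Build config (fun=> 0%:nng).

Definition cylinders : set (set config) :=
  [set C | exists (e : edge) (A : set R),
     measurable A /\ C = [set w : config | A (w e)%:num]].

Definition config_space := g_sigma_algebraType cylinders.

End Configurations.

Notation config_measure R := (probability (config_space R) R).

Section FirstPassagePercolation.
Variable R : realType.
Implicit Types (w : config R) (mu : config_measure R).

Definition path_time w (x : Z2) (p : seq Z2) : R :=
  \sum_(e <- pairmap edge_of x p) (w e)%:num.

Definition passage_time w (x y : Z2) : R :=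
  inf [set path_time w x p | p in [set p | path nn_adjacent x p /\ last x p = y]].

(* The x in Z^2 such that v lies in x + [-1/2, 1/2)^2. *)
Definition lattice_point (v : 'rV[R]_2) : Z2 :=
  (Num.floor (v 0 0 + 2^-1), Num.floor (v 0 1 + 2^-1)).

Definition passage_time_plane w (u v : 'rV[R]_2) : R :=
  passage_time w (lattice_point u) (lattice_point v).

Definition reached w (t : R) : set 'rV[R]_2 :=
  [set v | passage_time_plane w 0 v <= t].

Definition dilate (a : R) (A : set 'rV[R]_2) : set 'rV[R]_2 :=
  [set a *: v | v in A].

Definition axes_symmetric (A : set 'rV[R]_2) : Prop :=
  forall v, A v ->
    A (\row_j (if j == 0 then - v 0 j else v 0 j)) /\
    A (\row_j (if j == 0 then v 0 j else - v 0 j)).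

(* The restriction to eps < 1 is the usual reading of the shape theorem: for
   large eps the factor 1 - eps is a large negative number. *)
Definition is_limit_shape mu (B : set 'rV[R]_2) : Prop :=
  [/\ closed B, B !=set0, convex_set B, axes_symmetric B &
    forall eps : R, 0 < eps -> eps < 1 ->
      {ae mu, forall w, \forall t \near +oo,
        dilate (1 - eps) B `<=` dilate t^-1 (reached w t) /\
        dilate t^-1 (reached w t) `<=` dilate (1 + eps) B}].

(* There is at most one limit shape, so [get] picks it whenever it exists. *)
Definition limit_shape mu : set 'rV[R]_2 := get (is_limit_shape mu).

Definition lattice_act (f : Z2 -> Z2) (w : config R) : config R :=
  fun e => w (edge_of (f (edge_src e)) (f (edge_tgt e))).

Definition lattice_symmetry (f : Z2 -> Z2) : Prop :=
  bijective f /\ forall x y, nn_adjacent (f x) (f y) = nn_adjacent x y.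

Definition translation (v x : Z2) : Z2 := x + v.

Definition invariant_under mu (f : Z2 -> Z2) : Prop :=
  forall A : set (config_space R), measurable A ->
    mu (lattice_act f @^-1` A) = mu A.

Definition ergodic mu : Prop :=
  (forall v, invariant_under mu (translation v)) /\
  forall A : set (config_space R), measurable A ->
    (forall v, lattice_act (translation v) @^-1` A = A) ->
    mu A = 0%E \/ mu A = 1%E.

Definition has_lattice_symmetries mu : Prop :=
  forall f, lattice_symmetry f -> invariant_under mu f.

Definition unique_passage_times mu : Prop :=
  forall x y z : Z2, y != z ->
    mu [set w | passage_time w x y != passage_time w x z] = 1%E.

Definition finite_two_plus_moment mu : Prop :=
  forall e : edge, exists2 eps : R, 0 < eps &
    (\int[mu]_w (((w e)%:num `^ (2 + eps))%:E) < +oo)%E.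

Definition good mu : Prop :=
  [/\ ergodic mu, has_lattice_symmetries mu, unique_passage_times mu,
      finite_two_plus_moment mu &
      is_limit_shape mu (limit_shape mu) /\ bounded_set (limit_shape mu)].

Definition segment (a b : 'rV[R]_2) : set 'rV[R]_2 :=
  [set (1 - s) *: a + s *: b | s in `[0, 1]].

Definition boundary (A : set 'rV[R]_2) : set 'rV[R]_2 := closure A `\` A°.

Definition segment_in (D S : set 'rV[R]_2) : Prop :=
  S `<=` D /\ exists a b, a != b /\ S = segment a b.

(* The sides of a curve are the maximal nondegenerate segments it contains. *)
Definition sides_of (D : set 'rV[R]_2) : set (set 'rV[R]_2) :=
  [set S | segment_in D S /\
           forall S', segment_in D S' -> S `<=` S' -> S' = S].

(* Only used for the boundary of a convex set. *)
Definition is_polygon (D : set 'rV[R]_2) : Prop :=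
  finite_set (sides_of D) /\ D = \bigcup_(S in sides_of D) S.

Definition Sides mu : \bar R :=
  let D := boundary (limit_shape mu) in
  if `[< is_polygon D >] then (#|` fset_set (sides_of D)|%:R)%:E else +oo%E.

Section Growth.
Variables (k : nat) (xs : 'I_k -> Z2).

(* The site xs i, i : 'I_k, has label i.+1; label 0 means that no site wins. *)
Definition growth w (z : Z2) (t : R) : nat :=
  if [pick i : 'I_k | (passage_time w (xs i) z <= t) &&
       [forall j : 'I_k, (j != i) ==>
          (passage_time w (xs i) z < passage_time w (xs j) z)]]
  is Some i then i.+1 else 0%N.

(* A limit in the discrete space nat. *)
Definition growth_limit w (z : Z2) : nat :=
  lim (growth w z t @[t --> +oo]).

Definition coexistence : set (config_space R) :=
  [set w | forall i : 'I_k, infinite_set [set z | growth_limit w z = i.+1]].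

End Growth.

End FirstPassagePercolation.

(* Main.v *)
Require Import Defs.
From mathcomp Require Import all_boot all_order all_algebra.
From mathcomp Require Import finmap.
From mathcomp Require Import all_classical all_reals all_analysis.
From mathcomp Require Import measurable_realfun.
From mathcomp Require Import zify ring lra.

Set Implicit Arguments.
Unset Strict Implicit.
Unset Printing Implicit Defensive.

Import Order.TTheory GRing.Theory Num.Theory.
Import numFieldNormedType.Exports.
Local Open Scope classical_set_scope.
Local Open Scope ring_scope.

(** For a functional [a] supporting the limit shape B at v, let T_s(x) be the
    passage time from x to the half plane {a >= s}, and take x close to M v.
    By stationarity the mean of T_s(-x) - T_s(x) is an increment over a length
    L close to 2 M of a function of s growing linearly with slope 1, so for
    infinitely many s in an arithmetic progression of step L it is at least
    about 2 M.  As this difference is at most tau(-x, x), which is close to 2 M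
    by the shape theorem, it is close to 2 M with high probability.

    If y is close to M v' where v' is a boundary point such that [v, v'] is not
    contained in the boundary, then v + v' has gauge less than 2, hence
    tau(-x, y), which bounds T_s(-x) - T_s(y), is smaller by a multiple of M and
    T_s(x) < T_s(y): some site of the half plane is reached from x before it is
    reached from y.  This happens for infinitely many s with high probability.
    A limit shape with at least k sides has k boundary points such that no
    segment between two of them lies in the boundary: the midpoints of k sides,
    or k boundary points outside the sides. *)

(** * Convex bodies in the plane *)

Definition dotp {R : realType} (a v : 'rV[R]_2) : R :=
  a 0 0 * v 0 0 + a 0 1 * v 0 1.

Section PlaneVectors.
Context {R : realType}.
Implicit Types (a u v : 'rV[R]_2) (s : R).

Lemma dotpD a u v : dotp a (u + v) = dotp a u + dotp a v.
Proof. by rewrite /dotp !mxE; ring. Qed.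

Lemma dotpZ a s v : dotp a (s *: v) = s * dotp a v.
Proof. by rewrite /dotp !mxE; ring. Qed.

Lemma dotpB a u v : dotp a (u - v) = dotp a u - dotp a v.
Proof. by rewrite /dotp !mxE; ring. Qed.

Lemma ord2P (P : 'I_2 -> Prop) : P 0 -> P 1 -> forall j, P j.
Proof.
move=> P0 P1 [[|[|//]] h].
- by rewrite (_ : Ordinal h = 0)//; exact: val_inj.
- by rewrite (_ : Ordinal h = 1)//; exact: val_inj.
Qed.

Lemma rV2P u v : u 0 0 = v 0 0 -> u 0 1 = v 0 1 -> u = v.
Proof. by move=> h0 h1; apply/rowP; exact: ord2P. Qed.

Lemma norm_rV2_le v (e : R) : 0 <= e -> `|v 0 0| <= e -> `|v 0 1| <= e ->
  `|v| <= e.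
Proof.
move=> e0 h0 h1; rewrite [leLHS]mx_normrE; apply: bigmax_le => // -[i j] _ /=.
by rewrite ord1; move: j; exact: ord2P.
Qed.

Lemma coord_le_norm v j : `|v 0 j| <= `|v|.
Proof. by rewrite [leRHS]mx_normrE; exact: (le_bigmax _ (fun i => `|v i.1 i.2|) (0, j)). Qed.

Lemma dotp_le_norm a v : `|dotp a v| <= (`|a 0 0| + `|a 0 1|) * `|v|.
Proof.
rewrite /dotp (le_trans (ler_normD _ _))// !normrM mulrDl.
by rewrite lerD// ler_wpM2l// coord_le_norm.
Qed.

End PlaneVectors.

Lemma fset_inj (T : choiceType) k (A : set T) (F : {fset T}) :
  [set` F] `<=` A -> (k <= #|` F|)%N ->
  exists2 S : 'I_k -> T, injective S & forall i, A (S i).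
Proof.
move=> FA kF; case: k kF => [|k] kF.
  by exists (fun i : 'I_0 => False_rect T (notF (ltn_ord i))) => -[].
have [x0 _] : exists x0 : T, x0 \in F.
  by apply/fset0Pn; rewrite -cardfs_gt0; exact: leq_trans kF.
exists (fun i : 'I_k.+1 => nth x0 F i).
  move=> i j /eqP; rewrite nth_uniq ?fset_uniq//; first by move/eqP/val_inj.
  - exact: leq_trans (ltn_ord i) kF.
  - exact: leq_trans (ltn_ord j) kF.
by move=> i; apply: FA; rewrite /= mem_nth//; exact: leq_trans (ltn_ord i) kF.
Qed.

Section ConvexBody.
Context {R : realType}.
Variables (B : set 'rV[R]_2) (r : R).
Hypotheses (clB : closed B) (cvB : convex_set B) (bdB : bounded_set B).
Hypotheses (r0 : 0 < r) (Br : forall v : 'rV[R]_2, `|v| < r -> B v).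
Implicit Types (a u v x y : 'rV[R]_2) (s t : R).

Lemma convB s x y : 0 <= s -> s <= 1 -> B x -> B y -> B ((1 - s) *: x + s *: y).
Proof.
move=> s0 s1 Bx By.
have /mem_set Bx' := Bx; have /mem_set By' := By.
have := cvB (Itv01 s0 s1) By' Bx'.
by rewrite inE addrC; apply.
Qed.

Lemma B0 : B 0. Proof. by apply: Br; rewrite normr0. Qed.

Lemma scaleB s x : 0 <= s -> s <= 1 -> B x -> B (s *: x).
Proof. by move=> s0 s1 Bx; have := convB s0 s1 B0 Bx; rewrite scaler0 add0r. Qed.

Lemma subconvB s t x y : 0 <= s -> 0 <= t -> s + t <= 1 -> B x -> B y ->
  B (s *: x + t *: y).
Proof.
move=> s0 t0 st Bx By; have [st0|st0] := eqVneq (s + t) 0.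
  have [-> ->] : s = 0 /\ t = 0 by split; lra.
  by rewrite !scale0r addr0; exact: B0.
have st1 : 0 < s + t by rewrite lt_neqAle eq_sym st0 addr_ge0.
have -> : s *: x + t *: y = (s + t) *: ((1 - t / (s + t)) *: x + (t / (s + t)) *: y).
  by apply: rV2P; rewrite !mxE; field.
apply: scaleB => //; first exact: ltW.
apply: convB => //; first by rewrite divr_ge0// ltW.
by rewrite ler_pdivrMr// mul1r; lra.
Qed.

(** The ball of radius (1 - s) r around s x is (1 - s) times the ball of radius r around 0, shifted
    by s x; convexity keeps it inside [B]. *)
Lemma interior_scaleB s x : 0 <= s -> s < 1 -> B x -> B° (s *: x).
Proof.
move=> s0 s1 Bx; apply/nbhs_ballP; exists ((1 - s) * r) => /=.
  by rewrite mulr_gt0 ?subr_gt0.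
move=> z; rewrite -ball_normE /= => zx.
have -> : z = (1 - s) *: ((1 - s)^-1 *: (z - s *: x)) + s *: x.
  by rewrite scalerA mulfV ?scale1r ?subrK//; lra.
apply: convB => //; first exact: ltW.
apply: Br; rewrite normrZ gtr0_norm ?invr_gt0 ?subr_gt0//.
by rewrite mulrC ltr_pdivrMr ?subr_gt0// distrC mulrC.
Qed.

Lemma interior_extB x : B° x -> exists2 t, 1 < t & B (t *: x).
Proof.
move/nbhs_ballP => -[e /= e0 h].
have X0 : 0 < `|x| + 1 by rewrite ltr_wpDl.
exists (1 + e / (`|x| + 1) / 2).
  by rewrite ltrDl !divr_gt0.
apply: h; rewrite -ball_normE /= scalerDl scale1r opprD addrA subrr sub0r normrN.
rewrite normrZ gtr0_norm ?divr_gt0//.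
rewrite -!mulrA -[ltRHS]mulr1 ltr_pM2l// mulrA.
have : (`|x| + 1)^-1 * `|x| < 1 by rewrite mulrC ltr_pdivrMr// mul1r; lra.
have : 0 <= (`|x| + 1)^-1 * `|x| by rewrite mulr_ge0// invr_ge0 ltW.
by rewrite mulrAC; lra.
Qed.

Lemma boundaryE x : boundary B x <-> B x /\ ~ B° x.
Proof. by rewrite /boundary -(closure_id B).1. Qed.

Lemma boundary_extB t x : boundary B x -> 1 < t -> ~ B (t *: x).
Proof.
move=> /boundaryE[Bx nx] t1 Btx; apply: nx.
have t0 : 0 < t by lra.
rewrite -[x](@scalerK _ _ t) ?gt_eqF//.
by apply: interior_scaleB => //; rewrite ?invr_ge0 ?ltW// invf_lt1.
Qed.

(** The origin is interior to [B], so no supporting line passes through it and each can be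
    normalised to level 1; these [a] form the polar of [B]. *)
Definition supports a := forall y, B y -> dotp a y <= 1.

Definition face a : set 'rV[R]_2 := [set z | B z /\ dotp a z = 1].

Lemma face_boundary a : supports a -> face a `<=` boundary B.
Proof.
move=> sa x [Bx ax]; apply/boundaryE; split => // /interior_extB[t t1 /sa].
by rewrite dotpZ ax; lra.
Qed.

Lemma boundary_neq0 x : boundary B x -> x != 0.
Proof.
move=> /boundaryE[_ nx]; apply/eqP => x0; apply: nx.
by rewrite x0 -(scale0r 0); apply: interior_scaleB => //; exact: B0.
Qed.

(** Hahn-Banach by hand. In coordinates [ca], [cb] along [x] and its rotation [e], a functional
    worth 1 at [x] reads ca + c cb; the slope [c] must lie above the quotients given by points with
    cb < 0 and below those given by points with cb > 0. *)
Lemma supportB x : boundary B x -> exists2 a, supports a & dotp a x = 1.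
Proof.
move=> bx; have [Bx nx] := (boundaryE x).1 bx.
have x0 := boundary_neq0 bx.
pose N := x 0 0 ^+ 2 + x 0 1 ^+ 2.
have N0 : 0 < N.
  rewrite lt_neqAle eq_sym addr_ge0 ?sqr_ge0// andbT paddr_eq0 ?sqr_ge0//.
  rewrite !sqrf_eq0; apply: contra x0 => /andP[/eqP h0 /eqP h1]; apply/eqP.
  by apply: rV2P; rewrite mxE.
have Nn0 : N != 0 by rewrite gt_eqF.
pose e : 'rV[R]_2 := \row_j (if j == 0 then - x 0 1 else x 0 0).
have e0 : e 0 0 = - x 0 1 by rewrite mxE.
have e1 : e 0 1 = x 0 0 by rewrite mxE.
pose ca z := dotp x z / N; pose cb z := dotp e z / N.
have dec z : z = ca z *: x + cb z *: e.
  by apply: rV2P; rewrite !mxE /= /ca /cb /dotp e0 e1 /N; field.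
have cax : ca x = 1 by rewrite /ca /dotp -!expr2 divff.
have cbx : cb x = 0 by rewrite /cb /dotp e0 e1; field.
(* The chord from [y] to [z] meets the ray of [x] no further than [x]. *)
have key y z : B y -> B z -> 0 < cb y -> cb z < 0 ->
    (ca z - 1) / (- cb z) <= (1 - ca y) / cb y.
  move=> By Bz y0 z0; rewrite ler_pdivlMr// mulrAC ler_pdivrMr ?oppr_gt0//.
  rewrite leNgt; apply/negP => hlt.
  pose d := cb y - cb z; have d0 : 0 < d by rewrite /d; lra.
  have dn0 : d != 0 by rewrite gt_eqF.
  have Bw : B ((1 - cb y / d) *: y + (cb y / d) *: z).
    apply: convB => //; first by rewrite divr_ge0 ?ltW.
    by rewrite ler_pdivrMr// mul1r /d; lra.
  apply: (@boundary_extB ((cb y * ca z - cb z * ca y) / d) x bx).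
    by rewrite ltr_pdivlMr// mul1r /d; lra.
  rewrite (_ : _ *: x = (1 - cb y / d) *: y + (cb y / d) *: z)//.
  transitivity ((1 - cb y / d) *: (ca y *: x + cb y *: e) +
                (cb y / d) *: (ca z *: x + cb z *: e)); last by rewrite -!dec.
  rewrite !scalerDr !scalerA addrACA -!scalerDl.
  rewrite (_ : _ * cb y + _ = 0) ?scale0r ?addr0; last by rewrite /d; field; rewrite -/d.
  by congr (_ *: _); rewrite /d; field; rewrite -/d.
(* Multiples of [e] short enough to lie in [B], on both sides of the line of [x]: they make the set
   of slopes nonempty and bounded above. *)
pose r' := r / 2 / (`|e| + 1).
have E0 : 0 < `|e| + 1 by rewrite ltr_wpDl.
have r'0 : 0 < r' by rewrite !divr_gt0.
have Bse s : `|s| = 1 -> B ((s * r') *: e).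
  move=> s1; apply: Br; rewrite normrZ normrM s1 mul1r gtr0_norm//.
  rewrite /r' mulrAC ltr_pdivrMr//; have : 0 <= r * `|e| by rewrite mulr_ge0// ltW.
  by move: r0; lra.
have caes s : ca (s *: e) = 0 by rewrite /ca dotpZ /dotp e0 e1; field.
have cbes s : cb (s *: e) = s.
  by rewrite /cb dotpZ /dotp e0 e1 /N; field; rewrite -/N.
pose S := [set (ca z - 1) / (- cb z) | z in [set z | B z /\ cb z < 0]].
have S0 : S !=set0.
  exists ((ca ((-1 * r') *: e) - 1) / (- cb ((-1 * r') *: e))).
  by exists ((-1 * r') *: e) => //; split; [apply: Bse; rewrite normrN1|rewrite cbes; lra].
have Sub y : B y -> 0 < cb y -> ubound S ((1 - ca y) / cb y).
  by move=> By y0 _ [z [Bz z0] <-]; exact: key.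
have supS : has_sup S.
  split => //; exists ((1 - ca ((1 * r') *: e)) / cb ((1 * r') *: e)).
  by apply: Sub; [apply: Bse; rewrite normr1|rewrite cbes mul1r].
pose c := sup S; pose a := N^-1 *: (x + c *: e).
have dota z : dotp a z = ca z + c * cb z.
  by rewrite /ca /cb /a /dotp !mxE; field.
exists a; last by rewrite dota cax cbx; lra.
move=> z Bz; rewrite dota.
have [z0|z0|z0] := ltgtP (cb z) 0.
- have : (ca z - 1) / (- cb z) <= c by apply: sup_upper_bound => //; exists z.
  by rewrite ler_pdivrMr ?oppr_gt0//; lra.
- have : c <= (1 - ca z) / cb z by apply: ge_sup => //; exact: Sub.
  by rewrite ler_pdivlMr//; lra.
- rewrite z0 mulr0 addr0 leNgt; apply/negP => h.
  apply: (@boundary_extB (ca z) x bx) => //.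
  by move: Bz; rewrite {1}(dec z) z0 scale0r addr0.
Qed.

Lemma closed_ray_bound y z (S := [set s | B (y + s *: z)]) : z != 0 ->
  closed S /\ has_ubound S.
Proof.
move=> z0; split.
  apply: closed_comp => // s _.
  by apply: cvgD; [exact: cvg_cst|apply: cvgZl; exact: cvg_id].
have [M [_ hM]] := bdB.
exists ((`|M| + 1 + `|y|) / `|z|) => s /hM - /(_ (`|M| + 1)) h.
rewrite ler_pdivlMr ?normr_gt0//.
have : `|y + s *: z| <= `|M| + 1 by apply: h; rewrite (le_lt_trans (ler_norm _))// ltrDl.
have : `|s *: z| <= `|y + s *: z| + `|y|.
  by rewrite -{1}(addKr y (s *: z)) addrC (le_trans (ler_normB _ _)).
rewrite normrZ; have : s * `|z| <= `|s| * `|z| by rewrite ler_wpM2r// ler_norm.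
by lra.
Qed.

(** [B] is closed and bounded, so the supremum of the admissible parameters is attained. This yields
    the endpoints of faces and the radial projection to the boundary. *)
Lemma ray_last y z s0 : z != 0 -> B (y + s0 *: z) ->
  exists2 s, s0 <= s & B (y + s *: z) /\ forall t, B (y + t *: z) -> t <= s.
Proof.
move=> z0 Bs; have [cS uS] := closed_ray_bound y z0.
set S := [set s | B (y + s *: z)] in cS uS.
have S0 : S !=set0 by exists s0.
exists (sup S); first by apply: ub_le_sup.
split; last by move=> t St; apply: ub_le_sup.
by apply: cS; exact: closure_sup.
Qed.

Lemma radialB y : y != 0 -> exists2 t, 0 < t & boundary B (t *: y).
Proof.
move=> y0.
have Y0 : 0 < `|y| by rewrite normr_gt0.
have Bs0 : B (0 + (r / 2 / `|y|) *: y).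
  rewrite add0r; apply: Br; rewrite normrZ gtr0_norm ?divr_gt0// divfK ?gt_eqF//.
  by move: r0; lra.
have [t st [Bt tmax]] := ray_last y0 Bs0; rewrite add0r in Bt.
have t0 : 0 < t by apply: lt_le_trans st; rewrite !divr_gt0.
exists t => //; apply/boundaryE; split => // /interior_extB[u u1].
rewrite scalerA -[_ *: y]add0r => /tmax.
by rewrite ger_pMl// leNgt u1.
Qed.

Lemma segmentP (p q z : 'rV[R]_2) :
  segment p q z <-> exists2 s, 0 <= s <= 1 & z = p + s *: (q - p).
Proof.
have E s : (1 - s) *: p + s *: q = p + s *: (q - p).
  by apply: rV2P; rewrite !mxE; ring.
split=> [[s /= hs <-]|[s hs ->]]; exists s => //=; rewrite ?E//.
Qed.

Lemma segment_l (p q : 'rV[R]_2) : segment p q p.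
Proof. by apply/segmentP; exists 0; rewrite ?lexx ?ler01// scale0r addr0. Qed.

Lemma segment_r (p q : 'rV[R]_2) : segment p q q.
Proof. by apply/segmentP; exists 1; rewrite ?lexx ?ler01// scale1r addrC subrK. Qed.

(** The vectors z - p and q - p are both orthogonal to the nonzero vector [a], so their determinant
    vanishes ([cross]); dividing by a nonzero coordinate of q - p gives [s]. *)
Lemma dotp_eq_line a p q z : dotp a p = 1 -> dotp a q = 1 -> dotp a z = 1 ->
  p != q -> exists s, z = p + s *: (q - p).
Proof.
move=> ap aq az pq.
pose d0 := q 0 0 - p 0 0; pose d1 := q 0 1 - p 0 1.
have ad : a 0 0 * d0 + a 0 1 * d1 = 0.
  by move: ap aq; rewrite /dotp /d0 /d1 => <- h; lra.
have az' : a 0 0 * (z 0 0 - p 0 0) + a 0 1 * (z 0 1 - p 0 1) = 0.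
  by move: ap az; rewrite /dotp => <- h; lra.
have a0 : a 0 0 != 0 \/ a 0 1 != 0.
  have [a0|] := eqVneq (a 0 0) 0; [right|by left].
  by apply: contra_eq_neq ap => a1; rewrite /dotp a0 a1 !mul0r addr0 eq_sym oner_neq0.
have cross : (z 0 0 - p 0 0) * d1 = (z 0 1 - p 0 1) * d0.
  case: a0 => a0; apply/(mulfI a0).
  - transitivity (a 0 1 * (- (z 0 1 - p 0 1) * d1)); last first.
      by rewrite -[RHS]subr0 -(mulr0 (z 0 1 - p 0 1)) -ad; ring.
    by rewrite -[RHS]addr0 -(mulr0 d1) -az'; ring.
  - transitivity (a 0 0 * (- (z 0 0 - p 0 0) * d0)).
      by rewrite -[LHS]subr0 -(mulr0 (z 0 0 - p 0 0)) -ad; ring.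
    by rewrite -[LHS]addr0 -(mulr0 d0) -az'; ring.
have [d00|d00] := eqVneq d0 0; last first.
  exists ((z 0 0 - p 0 0) / d0); apply: rV2P; rewrite !mxE -/d0 -/d1.
    by field.
  by rewrite mulrAC cross; field.
have d10 : d1 != 0.
  apply: contra pq => /eqP d10; apply/eqP.
  by apply: rV2P; apply/esym/eqP; rewrite -subr_eq0; exact/eqP.
exists ((z 0 1 - p 0 1) / d1); apply: rV2P; rewrite !mxE -/d0 -/d1.
  by rewrite mulrAC -cross; field.
by field.
Qed.

(** The face lies on one line; its endpoints are the last points of [B] on the rays from [p] through
    [q] and from [q] through [p]. *)
Lemma face_segment a p q : face a p -> face a q -> p != q ->
  exists p' q', p' != q' /\ face a = segment p' q'.
Proof.
move=> [Bp ap] [Bq aq] pq.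
have d0 : q - p != 0 by rewrite subr_eq0 eq_sym.
have d0' : p - q != 0 by rewrite subr_eq0.
have B1 : B (p + 1 *: (q - p)) by rewrite scale1r addrC subrK.
have B2 : B (q + 1 *: (p - q)) by rewrite scale1r addrC subrK.
have [s s1 [Bs smax]] := ray_last d0 B1.
have [t t1 [Bt tmax]] := ray_last d0' B2.
pose p' := q + t *: (p - q); pose q' := p + s *: (q - p).
have n0 : s + t - 1 != 0 by rewrite gt_eqF//; lra.
(* In units of q - p, the two rays have lengths [s] and [t] and overlap in one unit. *)
have Ed : q' - p' = (s + t - 1) *: (q - p) by apply: rV2P; rewrite !mxE; ring.
have ad : dotp a (q - p) = 0 by rewrite dotpB ap aq subrr.
have ad' : dotp a (p - q) = 0 by rewrite dotpB ap aq subrr.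
exists p', q'; split; first by rewrite eq_sym -subr_eq0 Ed scaler_eq0 negb_or n0.
apply/seteqP; split => z.
  move=> [Bz az]; have [u zu] := dotp_eq_line ap aq az pq.
  apply/segmentP; exists ((u + t - 1) / (s + t - 1)).
    have us : u <= s by apply: smax; rewrite -zu.
    have ut : 1 - u <= t.
      by apply: tmax; rewrite (_ : _ + _ = z)// zu; apply: rV2P; rewrite !mxE; ring.
    by rewrite divr_ge0 ?ler_pdivrMr /=; lra.
  by rewrite Ed scalerA divfK// zu /p'; apply: rV2P; rewrite !mxE; ring.
move=> /segmentP[u /andP[u0 u1] ->]; split.
  rewrite (_ : _ + _ = (1 - u) *: p' + u *: q'); first exact: convB.
  by apply: rV2P; rewrite !mxE; ring.
by rewrite dotpD dotpZ Ed dotpZ ad /p' dotpD dotpZ ad' aq; ring.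
Qed.

(* A functional supporting at the midpoint of the segment is constant on it. *)
Lemma boundary_segment_face S : segment_in (boundary B) S ->
  exists2 a, supports a & S `<=` face a.
Proof.
move=> [SD [p [q [pq ES]]]].
have [|a sa am] := @supportB (p + 2^-1 *: (q - p)).
  by apply: SD; rewrite ES; apply/segmentP; exists 2^-1 => //; lra.
have Sp : S p by rewrite ES; exact: segment_l.
have Sq : S q by rewrite ES; exact: segment_r.
exists a => // z Sz.
have := Sz; rewrite ES => /segmentP[s /andP[s0 s1] zE].
have [Bp _] := (boundaryE p).1 (SD _ Sp).
have [Bq _] := (boundaryE q).1 (SD _ Sq).
have [Bz _] := (boundaryE z).1 (SD _ Sz).
split => //.
move: am; rewrite zE !dotpD !dotpZ !dotpB.
move: (sa _ Bp) (sa _ Bq); move=> h1 h2 h3.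
have [-> ->] : dotp a p = 1 /\ dotp a q = 1 by split; lra.
by rewrite subrr mulr0 addr0.
Qed.

(** A longer boundary segment lies in the face of some [b]; both level lines pass through the
    distinct points [p] and [q], so they coincide and the segment stays in the face of [a]. *)
Lemma face_side a p q : supports a -> face a p -> face a q -> p != q ->
  sides_of (boundary B) (face a).
Proof.
move=> sa fp fq pq.
have [p' [q' [pq' E]]] := face_segment fp fq pq.
split.
  by split; [exact: face_boundary|exists p', q'].
move=> S' /boundary_segment_face[b sb S'b] aS'; apply/seteqP; split => // z S'z.
have [Bz bz] := S'b _ S'z; split => //.
have [_ bp] := S'b _ (aS' _ fp); have [_ bq] := S'b _ (aS' _ fq).
have [s ->] := dotp_eq_line bp bq bz pq.
by rewrite dotpD dotpZ dotpB fp.2 fq.2 subrr mulr0 addr0.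
Qed.

(** A functional at most 1 at both points and averaging 1 over them equals 1 at each. *)
Lemma boundary_midpoint p q : B p -> B q -> boundary B (2^-1 *: (p + q)) ->
  exists a, [/\ supports a, face a p & face a q].
Proof.
move=> Bp Bq /supportB[a sa]; rewrite dotpZ dotpD => h.
have hp := sa _ Bp; have hq := sa _ Bq.
by exists a; split => //; split => //; lra.
Qed.

(** Testing midpoints suffices to exclude whole segments: by [boundary_midpoint], a midpoint on the
    boundary forces both ends into a common face. *)
Definition spread k (v : 'I_k -> 'rV[R]_2) :=
  (forall i, boundary B (v i)) /\
  (forall i j, i != j -> ~ boundary B (2^-1 *: (v i + v j))).

(** The points are the midpoints of the sides. A functional supporting [B] and equal to 1 at two of
    them is 1 on both whole sides, and maximality identifies each side with the face. *)
Lemma spread_sides k (S : 'I_k -> set 'rV[R]_2) :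
  injective S -> (forall i, sides_of (boundary B) (S i)) ->
  exists v : 'I_k -> 'rV[R]_2, spread v.
Proof.
move=> injS sS.
have /choice[p hp] : forall i, exists pq : 'rV[R]_2 * 'rV[R]_2,
    [/\ pq.1 != pq.2, S i = segment pq.1 pq.2 & S i `<=` boundary B].
  by move=> i; have [[h [p [q [pq E]]]] _] := sS i; exists (p, q).
pose v i := 2^-1 *: ((p i).1 + (p i).2).
have Spi i : S i (p i).1 by have [_ -> _] := hp i; exact: segment_l.
have Sqi i : S i (p i).2 by have [_ -> _] := hp i; exact: segment_r.
have Svi i : S i (v i).
  have [_ -> _] := hp i; apply/segmentP; exists 2^-1; first by lra.
  by apply: rV2P; rewrite /v !mxE; field.
have bS i z : S i z -> B z by have [_ _ h] := hp i => /h /boundaryE[].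
exists v; split => [i|i j ij bm]; first by have [_ _] := hp i; apply.
have [a [sa fi fj]] := boundary_midpoint (bS _ _ (Svi i)) (bS _ _ (Svi j)) bm.
have SE l : face a (v l) -> S l = face a.
  move=> [_]; rewrite /v dotpZ dotpD => h.
  have hp1 := sa _ (bS _ _ (Spi l)); have hq1 := sa _ (bS _ _ (Sqi l)).
  have [ap aq] : dotp a (p l).1 = 1 /\ dotp a (p l).2 = 1 by split; lra.
  have Sa : S l `<=` face a.
    move=> z Sz; split; first exact: (bS l).
    move: Sz; have [_ -> _] := hp l => /segmentP[s _ ->].
    by rewrite dotpD dotpZ dotpB ap aq subrr mulr0 addr0.
  have [pq _ _] := hp l.
  have [sa' _] := face_side sa (Sa _ (Spi l)) (Sa _ (Sqi l)) pq.
  by have [_ /(_ _ sa' Sa)] := sS l => <-.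
by move: ij; rewrite (injS i j) ?eqxx// (SE i)// (SE j).
Qed.

(** Two distinct points on a common face would make that face a side containing them. *)
Lemma spread_off_sides k (v : 'I_k -> 'rV[R]_2) : injective v ->
  (forall i, boundary B (v i)) ->
  (forall i S, sides_of (boundary B) S -> ~ S (v i)) ->
  spread v.
Proof.
move=> injv bv nS; split => // i j ij bm.
have Bv l : B (v l) by have /boundaryE[] := bv l.
have [a [sa fi fj]] := boundary_midpoint (Bv i) (Bv j) bm.
have vij : v i != v j by apply: contra ij => /eqP/injv ->.
exact: (nS i _ (face_side sa fi fj vij)).
Qed.

(** Moving from [x] along a supporting line and projecting radially gives boundary points close to
    [x]: the factor [t] lies between 1 / (1 + c s) and 1. The facts on [a] and [d] serve to tell
    these points apart. *)
Lemma boundary_near x (e : R) : boundary B x -> 0 < e ->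
  exists a (d : 'rV[R]_2) (s0 : R), [/\ dotp a x = 1, d != 0, dotp a d = 0, 0 < s0 &
    forall s, 0 <= s -> s <= s0 -> exists2 t, boundary B (t *: (x + s *: d)) &
      `|t *: (x + s *: d) - x| < e].
Proof.
move=> bx e0; have [a sa ax] := supportB bx.
have [Bx _] := (boundaryE x).1 bx.
pose d : 'rV[R]_2 := \row_j (if j == 0 then - a 0 1 else a 0 0).
have ad : dotp a d = 0 by rewrite /dotp !mxE /=; ring.
have d0 : d != 0.
  apply: contra_eq_neq ax => d0; rewrite /dotp.
  have -> : a 0 1 = 0.
    by apply/eqP; rewrite -oppr_eq0; move/rowP/(_ 0): d0; rewrite !mxE /= => ->.
  have -> : a 0 0 = 0 by move/rowP/(_ 1): d0; rewrite !mxE /=.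
  by rewrite !mul0r addr0 eq_sym oner_neq0.
have D0 : 0 < `|d| by rewrite normr_gt0.
(* Chosen so that d / c has norm r / 2 and hence lies in [B]. *)
pose c := 2 * `|d| / r; have c0 : 0 < c by rewrite divr_gt0// mulr_gt0.
have Bd : B (c^-1 *: d).
  apply: Br; rewrite normrZ gtr0_norm ?invr_gt0// /c invfM invrK.
  rewrite (_ : _ * _ = r / 2); last by field; rewrite gt_eqF.
  by move: r0; lra.
pose C := c * `|x| + `|d| + 1.
have C0 : 0 < C by rewrite ltr_wpDl// addr_ge0// mulr_ge0// ltW.
exists a, d, (e / C / 2); split => //; first by rewrite !divr_gt0.
move=> s s0 se.
have ay : dotp a (x + s *: d) = 1 by rewrite dotpD dotpZ ad mulr0 addr0.
have [|t t0 bt] := @radialB (x + s *: d).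
  by apply: contra_eq_neq ay => ->; rewrite /dotp !mxE !mulr0 addr0 eq_sym oner_neq0.
have [Bt nt] := (boundaryE _).1 bt.
have t1 : t <= 1 by have := sa _ Bt; rewrite dotpZ ay mulr1.
have cs0 : 0 <= c * s by rewrite mulr_ge0// ltW.
have cs1 : 0 < 1 + c * s by rewrite ltr_wpDr.
(* (x + s d) / (1 + c s) is a convex combination of [x] and d / c. Were the inequality to fail, the
   boundary point would be a multiple by less than 1 of a point of [B], hence interior. *)
have tlow : 1 <= t * (1 + c * s).
  rewrite leNgt; apply/negP => tlt; apply: nt.
  have -> : t *: (x + s *: d) = (t * (1 + c * s)) *:
      ((1 + c * s)^-1 *: x + (c * s / (1 + c * s)) *: (c^-1 *: d)).
    by apply: rV2P; rewrite !mxE; field; rewrite !gt_eqF.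
  apply: interior_scaleB => //; first by rewrite mulr_ge0 ?ltW.
  apply: subconvB => //.
  - by rewrite invr_ge0 ltW.
  - by rewrite divr_ge0// ltW.
  - by rewrite -[X in X + _]mul1r -mulrDl divff// gt_eqF.
exists t => //.
have -> : t *: (x + s *: d) - x = (t * s) *: d - (1 - t) *: x.
  by apply: rV2P; rewrite !mxE; ring.
apply: le_lt_trans (ler_normB _ _) _.
have t10 : 0 <= 1 - t by rewrite subr_ge0.
rewrite !normrZ !ger0_norm ?(ltW t0)//.
have h1 : t * s * `|d| <= s * `|d| by rewrite ler_wpM2r// ler_piMl.
have h2 : (1 - t) * `|x| <= c * s * `|x| by rewrite ler_wpM2r//; have := mulr_ge0 t10 cs0; lra.
have h3 : s * C <= e / 2.
  have := se; rewrite -(ler_pM2r C0) => /le_trans; apply.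
  by rewrite mulrAC divfK ?gt_eqF.
have h4 : s * C = c * s * `|x| + s * `|d| + s by rewrite /C; ring.
by lra.
Qed.

(** A finite union of sides is closed, so a neighbourhood of [x] avoids the sides, and
    [boundary_near] gives arbitrarily many boundary points in it. *)
Lemma off_sides k x : finite_set (sides_of (boundary B)) -> boundary B x ->
  ~ (\bigcup_(S in sides_of (boundary B)) S) x ->
  exists v : 'I_k -> 'rV[R]_2, spread v.
Proof.
move=> fS bx nx; set U := \bigcup_(S in _) S in nx.
have clU : closed U.
  apply: closed_bigcup => // S [[_ [p [q [_ ->]]]] _].
  apply: compact_closed; first exact: norm_hausdorff.
  apply: continuous_compact; last exact: segment_compact.
  apply: continuous_subspaceT => s.
  apply: cvgD; apply: cvgZl; last exact: cvg_id.
  by apply: cvgB; [exact: cvg_cst|exact: cvg_id].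
have /nbhs_ballP[e /= e0 he] : nbhs x (~` U).
  by apply: open_nbhs_nbhs; split => //; exact: closed_openC.
have [a [d [s0 [ax d0 ad s00 H]]]] := boundary_near bx e0.
have /choice[t ht] : forall i : 'I_k, exists t,
    boundary B (t *: (x + (s0 / i.+1%:R) *: d)) /\ ~ U (t *: (x + (s0 / i.+1%:R) *: d)).
  move=> i; have [||t bt nt] := H (s0 / i.+1%:R); first by rewrite divr_ge0// ltW.
    by rewrite ler_pdivrMr// ler_peMr ?(ltW s00)// ler1n.
  by exists t; split => //; apply: he; rewrite -ball_normE /= distrC.
exists (fun i => t i *: (x + (s0 / i.+1%:R) *: d)).
apply: spread_off_sides.
- move=> i j E.
  (* Applying [a] recovers [t], after which the distinct tangential offsets s0 / (i + 1) separate
     the points. *)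
  have tE : t i = t j.
    by have := congr1 (dotp a) E; rewrite !dotpZ !dotpD !dotpZ ax ad !mulr0 addr0 !mulr1.
  have tj0 : t j != 0.
    by have [/boundary_neq0 + _] := ht j; rewrite scaler_eq0 negb_or => /andP[].
  move: E; rewrite tE => /(scalerI tj0)/addrI/eqP.
  rewrite -subr_eq0 -scalerBl scaler_eq0 (negbTE d0) orbF subr_eq0.
  by move/eqP/(mulfI (lt0r_neq0 s00))/invr_inj/eqP; rewrite eqr_nat => /eqP[/val_inj].
- by move=> i; have [] := ht i.
- by move=> i S sS Sv; have [_] := ht i; apply; exists S.
Qed.

(** A polygon has enough sides by assumption. Otherwise there are infinitely many sides, or finitely
    many that fail to cover the boundary. *)
Lemma spread_exists k : let D := boundary B in
  (k%:R%:E <= if `[< is_polygon D >] then (#|` fset_set (sides_of D)|%:R)%:E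
              else +oo : \bar R)%E ->
  exists v : 'I_k -> 'rV[R]_2, spread v.
Proof.
move=> D; have many (F : {fset (set 'rV[R]_2)}) : [set` F] `<=` sides_of D ->
    (k <= #|` F|)%N -> exists v : 'I_k -> 'rV[R]_2, spread v.
  by move=> FD kF; have [S injS sS] := fset_inj FD kF; exact: (spread_sides injS sS).
case: asboolP => [[fS _]|nP _].
  rewrite lee_fin ler_nat; apply: many => S /=.
  by rewrite in_fset_set// inE.
have [fS|iS] := pselect (finite_set (sides_of D)); last first.
  by have [F FD kF] := infinite_set_fset k iS; exact: (many F).
have [x [Dx nx]] : exists x, D x /\ ~ (\bigcup_(S in sides_of D) S) x.
  apply: contrapT => h; apply: nP; split => //; apply/seteqP; split => x.
    by move=> Dx; apply: contrapT => nx; apply: h; exists x.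
  by move=> [S [[SD _] _] Sx]; exact: SD.
exact: (off_sides k fS Dx nx).
Qed.

(* That is, the gauge of [v i + v j] is at most [rho < 2]. *)
Lemma spread_dilate k (v : 'I_k -> 'rV[R]_2) : spread v ->
  exists rho : R, [/\ 0 < rho, rho < 2 & forall i j, i != j -> B (rho^-1 *: (v i + v j))].
Proof.
move=> [bv nv].
have Bv i : B (v i) by have /boundaryE[] := bv i.
have /choice[f hf] : forall p : 'I_k * 'I_k, exists t : R,
    1 < t /\ (p.1 != p.2 -> B (t *: (2^-1 *: (v p.1 + v p.2)))).
  move=> [i j] /=; have [ij|ij] := eqVneq i j; first by exists 2; rewrite ltr1n.
  have Bm : B (2^-1 *: (v i + v j)).
    by rewrite scalerDr; apply: subconvB => //; lra.
  have [|t t1 Bt] := @interior_extB (2^-1 *: (v i + v j)); last by exists t.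
  by apply: contrapT => nI; apply: (nv i j ij); apply/boundaryE.
pose m := \big[Num.max/0]_p (f p)^-1.
have m1 : m < 1.
  rewrite /m; elim/big_ind: _ => //; first by move=> x y x1 y1; rewrite gt_max x1.
  by move=> p _; rewrite invf_lt1; have [] := hf p; lra.
have mp p : (f p)^-1 <= m by exact: le_bigmax.
have m0 : 0 <= m by exact: bigmax_ge_id.
(* Doubling turns the gauge bound [m] for midpoints into one for sums; the maximum with 1 gives
   positivity at once. *)
pose rho := Num.max 1 (2 * m).
have rho1 : 1 <= rho by rewrite le_max lexx.
exists rho; split; [lra|by rewrite gt_max; lra|move=> i j ij].
have [t1 /(_ ij) Bt] := hf (i, j); set t := f (i, j) in t1 Bt.
have -> : rho^-1 *: (v i + v j) = (2 * t^-1 / rho) *: (t *: (2^-1 *: (v i + v j))).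
  by apply: rV2P; rewrite !mxE; field; rewrite !gt_eqF //; lra.
apply: scaleB => //; first by rewrite !mulr_ge0 ?invr_ge0//; lra.
rewrite ler_pdivrMr; last lra.
rewrite mul1r le_max; apply/orP; right; have := mp (i, j); rewrite -/t; lra.
Qed.

End ConvexBody.

(** * Passage times to sets of sites *)

(** The exact length is kept because it later bounds the number of edge moments by a multiple of the
    distance. *)
Lemma lattice_path (x y : Z2) : exists p,
  [/\ path nn_adjacent x p, last x p = y &
      (size p)%:Z = `|y.1 - x.1| + `|y.2 - x.2|].
Proof.
have [n] : exists n, (absz (y.1 - x.1) + absz (y.2 - x.2))%N = n by eexists.
case: y => y1 y2; elim: n x => [|n IH] [x1 x2] /= hn.
  have e1 : x1 = y1 by lia. have e2 : x2 = y2 by lia.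
  by exists [::]; rewrite /= e1 e2; split=> //; lia.
have step (z : Z2) : nn_adjacent (x1, x2) z ->
    (absz (y1 - z.1) + absz (y2 - z.2))%N = n -> exists p,
    [/\ path nn_adjacent (x1, x2) p, last (x1, x2) p = (y1, y2) &
      (size p)%:Z = `|y1 - x1| + `|y2 - x2|].
  move=> az hz; have [p [pp pl ps]] := IH z hz; exists (z :: p) => /=; rewrite az; split => //.
  by move: ps hz hn => /=; lia.
have [|] := eqVneq x1 y1 => h1.
  have [h2|h2] := ltP x2 y2; [apply: (step (x1, x2 + 1))|apply: (step (x1, x2 - 1))];
  rewrite /nn_adjacent /=; lia.
have [h2|h2] := ltP x1 y1; [apply: (step (x1 + 1, x2))|apply: (step (x1 - 1, x2))];
  rewrite /nn_adjacent /=; lia.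
Qed.

Section SetTime.
Context {R : realType}.
Implicit Types (w : config R) (x y z v : Z2) (A : set Z2) (p : seq Z2).

(** The infimum of the empty set is 0, hence the assumptions below that [A] is nonempty. *)
Definition set_time w x A : R :=
  inf [set path_time w x p | p in [set p | path nn_adjacent x p /\ A (last x p)]].

Lemma passage_timeE w x y : passage_time w x y = set_time w x [set y].
Proof. by []. Qed.

Lemma path_time_ge0 w x p : 0 <= path_time w x p.
Proof. by rewrite /path_time sumr_ge0. Qed.

Lemma path_time_cat w x p q :
  path_time w x (p ++ q) = path_time w x p + path_time w (last x p) q.
Proof. by rewrite /path_time pairmap_cat big_cat. Qed.

Lemma set_time_le w x A p : path nn_adjacent x p -> A (last x p) ->
  set_time w x A <= path_time w x p.
Proof.
move=> pp Ap; apply: ge_inf; last by exists p.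
by exists 0 => _ [q _ <-]; exact: path_time_ge0.
Qed.

Lemma set_time_has_inf w x A : A !=set0 ->
  has_inf [set path_time w x p | p in [set p | path nn_adjacent x p /\ A (last x p)]].
Proof.
move=> [y Ay]; have [p [pp pl _]] := lattice_path x y; split.
  by exists (path_time w x p); exists p => //; split => //; rewrite pl.
by exists 0 => _ [q _ <-]; exact: path_time_ge0.
Qed.

Lemma set_time_ge0 w x A : 0 <= set_time w x A.
Proof.
have [->|/set0P A0] := eqVneq A set0.
  rewrite /set_time (_ : [set _ | _ in _] = set0) ?inf0//.
  by rewrite -subset0 => ? [? []].
apply: lb_le_inf; first by have [] := set_time_has_inf w x A0.
by move=> _ [q _ <-]; exact: path_time_ge0.
Qed.

Lemma set_time_lt w x A c : A !=set0 -> set_time w x A < c ->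
  exists p, [/\ path nn_adjacent x p, A (last x p) & path_time w x p < c].
Proof.
move=> A0 h; have c0 : 0 < c - set_time w x A by rewrite subr_gt0.
have [_ [p [pp Ap] <-] hp] := inf_adherent c0 (set_time_has_inf w x A0).
by exists p; split => //; move: hp; rewrite -/(set_time w x A) addrC subrK.
Qed.

Lemma set_time_sub w x A z : A z -> set_time w x A <= passage_time w x z.
Proof.
move=> Az; apply: lb_le_inf.
  by have [] := @set_time_has_inf w x [set z] (ex_intro _ z erefl).
by move=> _ [p [pp pl] <-]; apply: set_time_le; rewrite ?pl.
Qed.

Lemma set_time_reach w x A c : A !=set0 -> set_time w x A < c ->
  exists2 z, A z & passage_time w x z < c.
Proof.
move=> A0 /(set_time_lt A0)[p [pp Ap pc]]; exists (last x p) => //.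
by apply: le_lt_trans pc; rewrite passage_timeE; exact: set_time_le.
Qed.

(** Concatenates paths within e / 2 of the two infima, which need not be attained. *)
Lemma set_time_triangle w x y A : A !=set0 ->
  set_time w x A <= passage_time w x y + set_time w y A.
Proof.
move=> A0; apply/ler_addgt0Pr => e e0.
have e20 : 0 < e / 2 by rewrite divr_gt0.
have y0 : [set y] !=set0 by exists y.
have [|p [pp pl ph]] := @set_time_lt w x _ (passage_time w x y + e / 2) y0.
  by rewrite -passage_timeE ltrDl.
have [|q [qq ql qh]] := @set_time_lt w y A (set_time w y A + e / 2) A0.
  by rewrite ltrDl.
have lpy : last x p = y by [].
apply: (@le_trans _ _ (path_time w x (p ++ q))).
  by apply: set_time_le; rewrite ?cat_path ?last_cat lpy// pp.
by rewrite path_time_cat lpy; lra.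
Qed.

Lemma lattice_act_translationE v w e :
  lattice_act (translation v) w e = w (e.1 + v, e.2).
Proof.
case: e => -[a b] d; case: v => v1 v2.
rewrite /lattice_act /edge_of /edge_src /edge_tgt /translation /=; congr (w _).
have -> : (a, b) + (v1, v2) = (a + v1, b + v2) by [].
by case: d => /=; congr pair; try congr pair; lia.
Qed.

Lemma edge_of_translation v x y :
  edge_of (x + v) (y + v) = ((edge_of x y).1 + v, (edge_of x y).2).
Proof.
case: x y v => x1 x2 [y1 y2] [v1 v2]; rewrite /edge_of /=.
have -> : (Num.min x1 y1, Num.min x2 y2) + (v1, v2) =
  (Num.min x1 y1 + v1, Num.min x2 y2 + v2) by [].
by congr pair; try congr pair; lia.
Qed.

Lemma path_time_translation v w x p :
  path_time (lattice_act (translation v) w) x p =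
  path_time w (x + v) [seq z + v | z <- p].
Proof.
elim: p x => [|y p IH] x; rewrite /path_time /= ?big_nil//.
rewrite !big_cons; congr (_ + _); last exact: IH.
by rewrite lattice_act_translationE edge_of_translation.
Qed.

Lemma path_translation v x p :
  path nn_adjacent (x + v) [seq z + v | z <- p] = path nn_adjacent x p.
Proof.
elim: p x => [//|y p IH] x /=; rewrite IH; congr (_ && _).
by case: x y v {p IH} => x1 x2 [y1 y2] [v1 v2]; rewrite /nn_adjacent /=; lia.
Qed.

Lemma set_time_translation v w x A :
  set_time (lattice_act (translation v) w) x A =
  set_time w (x + v) [set z | A (z - v)].
Proof.
congr inf; apply/seteqP; split => [_ [p [pp pl] <-]|_ [p [pp pl] <-]].
  exists [seq z + v | z <- p]; last by rewrite path_time_translation.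
  by split; [rewrite path_translation|rewrite /= (last_map (fun z => z + v)) addrK].
have E : p = [seq z + v | z <- [seq z - v | z <- p]].
  by rewrite -map_comp map_id_in// => z _; rewrite /= subrK.
exists [seq z - v | z <- p]; last by rewrite path_time_translation -E.
split; first by rewrite -(path_translation v) -E.
by move: pl; rewrite /= {1}E (last_map (fun z => z + v)) addrK.
Qed.

Lemma passage_time_translation v w x y :
  passage_time (lattice_act (translation v) w) x y =
  passage_time w (x + v) (y + v).
Proof.
rewrite passage_timeE set_time_translation passage_timeE; congr set_time.
by apply/seteqP; split => z /=; [move/eqP; rewrite subr_eq => /eqP|move=> ->; rewrite addrK].
Qed.

End SetTime.

(** * Measurability of passage times *)

Section Measurability.
Context {R : realType}.
Notation cspace := (config_space R).
Implicit Types (w : config R) (x y z v : Z2) (A : set Z2) (p : seq Z2).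

Lemma measurable_edge (e : edge) : measurable_fun [set: cspace] (fun w => (w e)%:num).
Proof.
move=> _ A mA; rewrite setTI; apply: sub_sigma_algebra.
by exists e, A.
Qed.

Lemma measurable_path_time x p : measurable_fun [set: cspace] (fun w => path_time w x p).
Proof.
by apply: measurable_sum => e; exact: measurable_edge.
Qed.

(** There are countably many finite paths, so for nonempty [A] the time is below [c] on a countable
    union of measurable events; for empty [A] it is constantly 0. *)
Lemma measurable_set_time x A : measurable_fun [set: cspace] (fun w => set_time w x A).
Proof.
have [->|/set0P A0] := eqVneq A set0.
  apply: (eq_measurable_fun (cst (0 : R))); last exact: measurable_cst.
  move=> w _; rewrite /set_time (_ : [set _ | _ in _] = set0) ?inf0//.
  by rewrite -subset0 => ? [? []].
apply: (measurability _ (RGenInftyO.measurableE R)) => _ [_ [c ->] <-]; rewrite setTI.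
rewrite (_ : _ @^-1` _ = \bigcup_p [set w : cspace |
    (path nn_adjacent x p /\ A (last x p)) /\ path_time w x p < c]).
  apply: countable_bigcupT_measurable => // p.
  have [Pp|nP] := pselect (path nn_adjacent x p /\ A (last x p)); last first.
    by rewrite (_ : [set _ | _] = set0)// -subset0 => w [].
  rewrite (_ : [set _ | _] = (fun w : cspace => path_time w x p) @^-1` `]-oo, c[).
    by rewrite -[X in measurable X]setTI; apply: measurable_path_time.
  by apply/seteqP; split => w /=; rewrite in_itv /=; [case|split].
apply/seteqP; split => w /=; rewrite ?in_itv /=.
  by move=> /(set_time_lt A0)[p [pp Ap pc]]; exists p.
by move=> [p _ [[pp Ap]]] /=; apply: le_lt_trans; exact: set_time_le.
Qed.

Lemma measurable_passage_time x y :
  measurable_fun [set: cspace] (fun w => passage_time w x y).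
Proof. exact: (measurable_set_time x [set y]). Qed.

Lemma measurable_translation v :
  measurable_fun [set: cspace] (lattice_act (translation v) : cspace -> cspace).
Proof.
apply: (@measurability _ _ cspace cspace setT _ (@cylinders R) erefl) =>
  _ [_ [e [A [mA ->]]] <-]; rewrite setTI.
apply: sub_sigma_algebra; exists (e.1 + v, e.2), A; split => //.
by apply/seteqP; split => w /=; rewrite lattice_act_translationE.
Qed.

End Measurability.

(** * Stationarity and edge moments *)

Section Invariance.
Context {R : realType}.
Variable mu : config_measure R.
Hypothesis inv_mu : forall v, invariant_under mu (translation v).
Notation cspace := (config_space R).
Implicit Types (v x y : Z2) (e : edge).

Lemma integral_translation v (f : cspace -> \bar R) :
  measurable_fun [set: cspace] f -> (forall w, 0 <= f w)%E ->
  (\int[mu]_w f (lattice_act (translation v) w) = \int[mu]_w f w)%E.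
Proof.
move=> mf f0; have mt := measurable_translation v (R := R).
have := ge0_integral_pushforward mt mu measurableT mf (fun w _ => f0 w).
rewrite preimage_setT /= => <-.
by apply: eq_measure_integral => A mA _; exact: inv_mu.
Qed.

Lemma mu_translation v (P : set cspace) : measurable P ->
  mu [set w | P (lattice_act (translation v) w)] = mu P.
Proof. exact: inv_mu. Qed.

(** Stationarity reduces the uniform bound to the two edges coded at the origin, and t^2 <= 1 + t^(2
    + d) makes their second moments finite. *)
Lemma edge_second_moment : finite_two_plus_moment mu ->
  exists2 K : R, 0 <= K & forall e, (\int[mu]_w (((w e)%:num ^+ 2)%:E) <= K%:E)%E.
Proof.
move=> fm.
have mom e : exists2 K : R, 0 <= K & (\int[mu]_w (((w e)%:num ^+ 2)%:E) <= K%:E)%E.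
  have [d d0 hd] := fm e.
  have m2 : measurable_fun [set: cspace] (fun w : cspace => (((w e)%:num ^+ 2)%:E)).
    by apply/measurable_EFinP; apply: measurable_funX; exact: measurable_edge.
  have mp : measurable_fun [set: cspace] (fun w : cspace => (((w e)%:num `^ (2 + d))%:E)).
    apply/measurable_EFinP.
    by apply: (measurableT_comp (measurable_powR (2 + d))); exact: measurable_edge.
  have le1 : (\int[mu]_w (((w e)%:num ^+ 2)%:E) <=
      \int[mu]_w (1%:E + ((w e)%:num `^ (2 + d))%:E))%E.
    apply: ge0_le_integral => //.
    - by apply: emeasurable_funD => //; exact: measurable_cst.
    - move=> w _; rewrite -EFinD lee_fin.
      have [h|h] := leP (w e)%:num 1.
        by rewrite ler_wpDr ?powR_ge0// expr_le1.
      rewrite ler_wpDl// -powR_mulrn//.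
      by apply: ler_powR; [exact: ltW|rewrite lerDl ltW].
  have fin : (\int[mu]_w (1%:E + ((w e)%:num `^ (2 + d))%:E) < +oo)%E.
    rewrite ge0_integralD// integral_cst// mul1e.
    apply: lte_add_pinfty => //.
    exact: le_lt_trans (probability_le1 mu measurableT) (ltry 1).
  exists (fine (\int[mu]_w (((w e)%:num ^+ 2)%:E))).
    by apply: fine_ge0; apply: integral_ge0 => w _; rewrite lee_fin sqr_ge0.
  rewrite fineK// ge0_fin_numE; first exact: le_lt_trans fin.
  by apply: integral_ge0 => w _; rewrite lee_fin sqr_ge0.
have [K1 K10 h1] := mom (0, true); have [K2 K20 h2] := mom (0, false).
exists (K1 + K2); first exact: addr_ge0.
move=> [x b].
have -> : (\int[mu]_w (((w (x, b))%:num ^+ 2)%:E) =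
          \int[mu]_w (((w (0, b))%:num ^+ 2)%:E))%E.
  rewrite -(@integral_translation x (fun w => ((w (0, b))%:num ^+ 2)%:E)).
  - by apply: eq_integral => w _; rewrite lattice_act_translationE /= add0r.
  - by apply/measurable_EFinP; apply: measurable_funX; exact: measurable_edge.
  - by move=> w; rewrite lee_fin sqr_ge0.
by case: b; [apply: le_trans h1 _|apply: le_trans h2 _]; rewrite lee_fin; lra.
Qed.

End Invariance.

(** * Events occurring infinitely often *)

(** If every late increment were smaller, [g] would grow by at most (1 - 2 d) L per step, against
    the slope (1 - d) L. *)
Lemma increment_frequently (R : realType) (g : nat -> R) (L d : R) :
  0 < L -> 0 < d -> (\forall m \near \oo, (1 - d) * (m%:R * L) <= g m) ->
  forall m0, exists2 m, (m0 <= m)%N & (1 - 2 * d) * L <= g m.+1 - g m.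
Proof.
move=> L0 d0 gL m0; apply: contrapT => h.
have step m : (m0 <= m)%N -> g m.+1 - g m < (1 - 2 * d) * L.
  by move=> mm; rewrite ltNge; apply/negP => hm; apply: h; exists m.
have bound n : g (m0 + n)%N <= g m0 + n%:R * ((1 - 2 * d) * L).
  elim: n => [|n IH]; first by rewrite addn0 mul0r addr0.
  have := step (m0 + n)%N (leq_addr _ _).
  by rewrite addnS -natr1; lra.
(* An [n] for which the gap n d L exceeds the head start g(m0) - (1 - d) m0 L. *)
have [n [hn1 hn2]] : exists n : nat, (1 - d) * ((m0 + n)%:R * L) <= g (m0 + n)%N /\
    (g m0 - (1 - d) * (m0%:R * L)) / (d * L) < n%:R.
  have [N _ hN] := gL.
  have [N' _ hN'] := nbhs_infty_gtr ((g m0 - (1 - d) * (m0%:R * L)) / (d * L)).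
  exists (N + N')%N; split; last by apply: hN'; rewrite /= leq_addl.
  by apply: hN; rewrite /= addnCA leq_addr.
move: hn2; rewrite ltr_pdivrMr ?mulr_gt0//.
by move: (bound n) hn1; rewrite natrD; lra.
Qed.

(** The event is an increasing union of tail intersections, each contained in some [E m] of
    probability at most [e]. This bounds the probability that only finitely many complements
    occur. *)
Lemma liminf_mu_le d (T : measurableType d) (R : realType) (mu : probability T R)
    (E : nat -> set T) (e : R) :
  (forall n, measurable (E n)) ->
  (forall n, exists2 m, (n <= m)%N & (mu (E m) <= e%:E)%E) ->
  (mu (\bigcup_n \bigcap_(m in [set m | (n <= m)%N]) E m) <= e%:E)%E.
Proof.
move=> mE hE; set F := fun n => \bigcap_(m in [set m | (n <= m)%N]) E m.
have mF n : measurable (F n) by apply: bigcap_measurable => //; exists n => /=.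
have := @nondecreasing_cvg_mu _ _ _ mu F mF (bigcupT_measurable _ mF) _.
have ndF : {homo F : n m / (n <= m)%N >-> (n <= m)%O}.
  by move=> n m nm; apply/subsetPset => w Fw j /= mj; apply: Fw; exact: leq_trans mj.
move/(_ ndF) => cF; apply: (cvge_le _ cF); apply: nearW => n /=.
have [m nm hm] := hE n; apply: le_trans hm; apply: le_measure; rewrite ?inE//.
by move=> w; apply.
Qed.

Lemma bigsetU_mu_le d (T : measurableType d) (R : realType) (mu : probability T R)
    k (E : 'I_k -> set T) (e : R) :
  (forall i, measurable (E i)) -> (forall i, (mu (E i) <= e%:E)%E) ->
  (mu (\big[setU/set0]_i E i) <= (k%:R * e)%:E)%E.
Proof.
move=> mE hE; rewrite (_ : k%:R * e = \sum_(i < k) e); last first.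
  by rewrite sumr_const card_ord mulr_natl.
suff : measurable (\big[setU/set0]_i E i) /\
    (mu (\big[setU/set0]_i E i) <= (\sum_(i < k) e)%:E)%E by case.
elim/big_rec2: _ => [|i c A _ [mA hA]]; first by rewrite measure0.
split; first exact: measurableU.
rewrite EFinD; apply: (le_trans (measureU2 _ (mE i) mA)).
exact: leeD (hE i) hA.
Qed.

(** Continuity from above along the tail unions, which decrease to the null set where infinitely
    many of the events occur. *)
Lemma ae_eventually_mu d (T : measurableType d) (R : realType)
    (mu : probability T R) (E : nat -> set T) (c : R) :
  (forall n, measurable (E n)) ->
  {ae mu, forall w, \forall n \near \oo, ~ E n w} -> 0 < c ->
  \forall n \near \oo, (mu (E n) <= c%:E)%E.
Proof.
move=> mE [N [mN N0 hN]] c0.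
have mtail n : measurable (\bigcup_(k in [set k | (n <= k)%N]) E k).
  by apply: bigcup_measurable.
have lim0 : mu (lim_sup_set E) = 0%E.
  apply: (@subset_measure0 _ _ _ mu _ N) => //.
  - by apply: bigcapT_measurable.
  - move=> w hw; apply: hN => /= -[n _ hn].
    have [j nj Ej] := hw n I; exact: (hn j nj).
have cv : mu (\bigcup_(k in [set k | (n <= k)%N]) E k) @[n --> \oo] --> 0%E.
  rewrite -lim0; apply: lim_sup_set_cvg => //.
  exact: le_lt_trans (probability_le1 mu (mtail 0%N)) (ltry 1).
have : \forall n \near \oo, (mu (\bigcup_(k in [set k | (n <= k)%N]) E k) < c%:E)%E.
  have c0' : (0 < c%:E)%E by rewrite lte_fin.
  exact: cv _ (open_ereal_lt' c0').
apply: filterS => n /ltW; apply: le_trans.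
by apply: le_measure; rewrite ?inE// => w Ew; exists n => /=.
Qed.

(** * Hitting times of half planes *)

Section LatticePoints.
Context {R : realType}.
Implicit Types (v : 'rV[R]_2) (z : Z2).

Definition emb z : 'rV[R]_2 := \row_j (if j == 0 then z.1%:~R else z.2%:~R).

Lemma emb0E z : emb z 0 0 = z.1%:~R. Proof. by rewrite mxE. Qed.
Lemma emb1E z : emb z 0 1 = z.2%:~R. Proof. by rewrite mxE. Qed.

Lemma embD z z' : emb (z + z') = emb z + emb z'.
Proof. by apply: rV2P; rewrite !mxE /= intrD. Qed.

Lemma embN z : emb (- z) = - emb z.
Proof. by apply: rV2P; rewrite !mxE /= mulrNz. Qed.

Lemma embB z z' : emb (z - z') = emb z - emb z'.
Proof. by rewrite embD embN. Qed.

Lemma floor_half (n : int) : Num.floor (n%:~R + 2^-1 : R) = n.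
Proof. by apply/floor_def; rewrite intrD; lra. Qed.

Lemma lattice_point_emb z : lattice_point (emb z) = z.
Proof. by rewrite /lattice_point emb0E emb1E !floor_half -surjective_pairing. Qed.

Lemma lattice_point_small v : `|v| < 2^-1 -> lattice_point v = 0.
Proof.
move=> hv; have small j : Num.floor (v 0 j + 2^-1) = 0.
  have := le_lt_trans (coord_le_norm v j) hv; rewrite ltr_norml => /andP[h1 h2].
  by apply/floor_def; rewrite add0r; lra.
by rewrite /lattice_point !small.
Qed.

Lemma emb_lattice_point v : `|emb (lattice_point v) - v| <= 2^-1.
Proof.
have h j : `|(Num.floor (v 0 j + 2^-1))%:~R - v 0 j| <= 2^-1.
  have h1 := floor_le (v 0 j + 2^-1); have h2 := floorD1_gt (v 0 j + 2^-1).
  by rewrite ler_norml; move: h1 h2; rewrite intrD; lra.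
by apply: norm_rV2_le; rewrite ?invr_ge0// !mxE /=; [exact: (h 0)|exact: (h 1)].
Qed.

End LatticePoints.

(** * Consequences of the shape theorem *)

Section ShapeTheorem.
Context {R : realType}.
Variables (mu : config_measure R) (B : set 'rV[R]_2).
Hypothesis shB : is_limit_shape mu B.
Hypothesis inv_mu : forall v, invariant_under mu (translation v).
Notation cspace := (config_space R).
Implicit Types (a v : 'rV[R]_2) (x y z : Z2).

Lemma passage_time_refl (w : config R) x : passage_time w x x <= 0.
Proof.
have : path_time w x [::] = 0 by rewrite /path_time big_nil.
by move=> <-; exact: (@set_time_le _ w x [set x] [::]).
Qed.

(** For a suitable large [t] and some configuration, the reached set contains a ball around 0 inside
    the cell of the origin, and its 1 / t multiple is inside 3/2 [B]. *)
Lemma limit_shape_ball : exists2 r : R, 0 < r & forall v : 'rV[R]_2, `|v| < r -> B v.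
Proof.
have [_ _ _ _ /(_ 2^-1)] := shB; rewrite invr_gt0 invf_lt1 ?ltr0n// ltr1n => /(_ isT isT) sh.
have pf : ProperFilter (almost_everywhere mu).
  have h : (0 < mu [set: cspace])%E by rewrite probability_setT lte01.
  exact: ae_properfilter_algebraOfSetsType h.
have [w hw] := filter_ex sh.
have [t [[_ ht] t0]] : exists t : R, (dilate (1 - 2^-1) B `<=` dilate t^-1 (reached w t) /\
    dilate t^-1 (reached w t) `<=` dilate (1 + 2^-1) B) /\ 0 < t.
  apply: (@filter_ex _ (pinfty_nbhs R)); apply: filterI; first exact: hw.
  exact: nbhs_pinfty_gt.
(* For |v| < 1 / (3 t), the point (3/2) t v has norm below 1/2, so it lies in the cell of the
   origin. *)
exists (3^-1 / t); first by rewrite divr_gt0.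
move=> v hv.
have [|b Bb /(congr1 (fun u => (1 + 2^-1)^-1 *: u))] := ht ((1 + 2^-1) *: v).
  exists (t *: ((1 + 2^-1) *: v)); last by rewrite scalerA mulVf ?scale1r// gt_eqF.
  rewrite /reached /passage_time_plane /= !lattice_point_small ?normr0 ?invr_gt0//.
    by apply: le_trans (passage_time_refl _ _) _; rewrite ltW.
  rewrite !normrZ !gtr0_norm//.
  by move: hv; rewrite ltr_pdivlMr//; lra.
by rewrite !scalerA mulVf ?scale1r; [move=> <-|lra].
Qed.

Definition half_plane a (s : R) : set Z2 := [set z | s <= dotp a (emb z)].

Lemma half_plane_neq0 a v s : dotp a v = 1 -> half_plane a s !=set0.
Proof.
move=> av; pose C := (`|a 0 0| + `|a 0 1|) * 2^-1.
exists (lattice_point ((s + C) *: v)); rewrite /half_plane /=.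
have := dotp_le_norm a (emb (lattice_point ((s + C) *: v)) - (s + C) *: v).
have : (`|a 0 0| + `|a 0 1|) * `|emb (lattice_point ((s + C) *: v)) - (s + C) *: v| <= C.
  by rewrite ler_wpM2l ?addr_ge0// emb_lattice_point.
move=> h1 h2; have := le_trans h2 h1.
by rewrite dotpB dotpZ av ler_norml => /andP[]; lra.
Qed.

(** A site [z] reached before time (1 - d) s has z / ((1 - d) s) in (1 + d) B, so [a] is at most (1
    - d^2) s at [z], which is less than [s]. *)
Lemma half_plane_time_ae a v (d : R) : supports B a -> dotp a v = 1 -> 0 < d -> d < 1 ->
  {ae mu, forall w, \forall s \near +oo, (1 - d) * s <= set_time w 0 (half_plane a s)}.
Proof.
move=> sa av d0 d1; have [_ _ _ _ /(_ d d0 d1)] := shB.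
apply: (@filterS _ _ (ae_filter_ringOfSetsType mu)) => w hw.
have c0 : 0 < 1 - d by lra.
have ht : \forall s \near +oo,
    dilate (1 - d) B `<=` dilate ((1 - d) * s)^-1 (reached w ((1 - d) * s)) /\
    dilate ((1 - d) * s)^-1 (reached w ((1 - d) * s)) `<=` dilate (1 + d) B.
  exact: (gt0_cvgMry c0 cvg_id hw).
near=> s.
have s0 : 0 < s by near: s; exact: nbhs_pinfty_gt.
have [_ hs] : dilate (1 - d) B `<=` dilate ((1 - d) * s)^-1 (reached w ((1 - d) * s)) /\
    dilate ((1 - d) * s)^-1 (reached w ((1 - d) * s)) `<=` dilate (1 + d) B.
  by near: s.
rewrite leNgt; apply/negP => /(set_time_reach (half_plane_neq0 s av))[z sz zt].
have t0 : 0 < (1 - d) * s by rewrite mulr_gt0.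
have [|b Bb /(congr1 (fun u => dotp a (((1 - d) * s) *: u)))] :=
  hs (((1 - d) * s)^-1 *: emb z).
  exists (emb z) => //; rewrite /reached /passage_time_plane /= lattice_point_emb.
  by rewrite lattice_point_small ?normr0 ?invr_gt0// ltW.
rewrite !dotpZ mulVKf ?gt_eqF//.
have := sa _ Bb; move: sz; rewrite /half_plane /= => h1 h2.
have h3 : (1 - d) * s * ((1 + d) * dotp a b) <= (1 - d) * s * (1 + d).
  by rewrite ler_pM2l// ger_pMr//; lra.
have : 0 < d * d * s by rewrite !mulr_gt0.
by lra.
Unshelve. all: by end_near. Qed.

(** By time M rho' the reached set contains M rho' (1 - d) B. This contains [y M] for large [M],
    since the gauge of [v] is at most rho < rho' (1 - d) and the rounding error is bounded. *)
Lemma passage_time_ae (y : nat -> Z2) v (c rho rho' : R) :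
  (forall M, `|emb (y M) - M%:R *: v| <= c) -> 0 < rho -> rho < rho' ->
  B (rho^-1 *: v) ->
  {ae mu, forall w, \forall M \near \oo, passage_time w 0 (y M) <= M%:R * rho'}.
Proof.
move=> hy rho0 rho1 Bv.
have [clB _ cvB _ _] := shB.
have [r r0 Br] := limit_shape_ball.
have rho'0 : 0 < rho' by lra.
pose d := (1 - rho / rho') / 2.
have q1 : rho / rho' < 1 by rewrite ltr_pdivrMr// mul1r.
have q0 : 0 < rho / rho' by rewrite divr_gt0.
have d0 : 0 < d by rewrite /d; lra.
have d1 : d < 1 by rewrite /d; lra.
have dq : rho / rho' < 1 - d by rewrite /d; lra.
have [_ _ _ _ /(_ d d0 d1)] := shB.
apply: (@filterS _ _ (ae_filter_ringOfSetsType mu)) => w hw.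
have cM : (M%:R * rho') @[M --> \oo] --> +oo%R.
  apply/cvgryPge => A; have := nbhs_infty_gtr (A / rho').
  by apply: filterS => M; rewrite ltr_pdivrMr// => /ltW.
(* Weight of the main term v / rho; the weight of the rounding error tends to 0, so eventually the
   two sum to at most 1. *)
pose s := rho / rho' / (1 - d).
have s0 : 0 <= s by rewrite !divr_ge0// ltW//; lra.
have s1 : s < 1 by rewrite ltr_pdivrMr ?mul1r//; lra.
pose c1 := `|c| + 1; have c10 : 0 < c1 by rewrite ltr_wpDl.
have ht : \forall M \near \oo,
    dilate (1 - d) B `<=` dilate (M%:R * rho')^-1 (reached w (M%:R * rho')).
  have hw1 : \forall t \near +oo, dilate (1 - d) B `<=` dilate t^-1 (reached w t).
    by move: hw; apply: filterS => t [].
  exact: cM hw1.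
near=> M.
have M0 : 0 < M%:R :> R by rewrite ltr0n; near: M; exact: nbhs_infty_gt.
have t0 : 0 < M%:R * rho' by rewrite mulr_gt0.
have tbig : (2 * c1 / (r * (1 - d))) / (1 - s) <= M%:R * rho'.
  by near: M; move/cvgryPge : cM; exact.
have hM : dilate (1 - d) B `<=` dilate (M%:R * rho')^-1 (reached w (M%:R * rho')).
  by near: M.
have [|b hb /eqP] := hM (((M%:R * rho'))^-1 *: emb (y M)) => //.
  pose s' := 2 * c1 / (r * (1 - d)) / (M%:R * rho').
  exists (s *: (rho^-1 *: v) +
     s' *: ((r / (2 * c1)) *: (emb (y M) - M%:R *: v))).
    apply: (subconvB cvB r0 Br) => //.
    - by rewrite !divr_ge0// ?mulr_ge0//; lra.
    - by rewrite -lerBrDl ler_pdivrMr// [leRHS]mulrC -ler_pdivrMr ?subr_gt0.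
    - apply: Br; rewrite normrZ gtr0_norm ?divr_gt0 ?mulr_gt0//.
      rewrite mulrAC ltr_pdivrMr ?mulr_gt0// ltr_pM2l//.
      apply: le_lt_trans (hy M) _; apply: le_lt_trans (ler_norm _) _.
      by rewrite /c1; have := normr_ge0 c; lra.
  apply: rV2P; rewrite !mxE /s /s'; field; rewrite !gt_eqF//; lra.
rewrite (can_eq (scalerK _)) ?invr_eq0 ?gt_eqF// => /eqP E.
move: hb; rewrite /reached /passage_time_plane /= E lattice_point_emb.
by rewrite lattice_point_small// normr0 invr_gt0.
Unshelve. all: by end_near. Qed.

Lemma measurable_le_cst (f : cspace -> R) c : measurable_fun [set: cspace] f ->
  measurable [set w | f w <= c].
Proof.
move=> mf; rewrite (_ : [set _ | _] = f @^-1` `]-oo, c]).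
  by rewrite -[X in measurable X]setTI; apply: mf.
by apply/seteqP; split => w; rewrite /= in_itv.
Qed.

Lemma measurable_lt_fun (f g : cspace -> R) : measurable_fun [set: cspace] f ->
  measurable_fun [set: cspace] g -> measurable [set w | f w < g w].
Proof.
move=> mf mg; rewrite (_ : [set _ | _] = (g \- f) @^-1` `]0, +oo[).
  by rewrite -[X in measurable X]setTI; apply: measurable_funB.
by apply/seteqP; split => w; rewrite /= in_itv /= andbT subr_gt0.
Qed.

Lemma half_plane_time_mu a v (L d : R) : supports B a -> dotp a v = 1 -> 0 < L ->
  0 < d -> d < 1 ->
  \forall m \near \oo, (mu [set w : cspace |
     (set_time w 0 (half_plane a (m%:R * L)) < (1 - d) * (m%:R * L))%R] <= d%:E)%E.
Proof.
move=> sa av L0 d0 d1; apply: (@ae_eventually_mu _ cspace R mu) => //.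
  move=> n; apply: measurable_lt_fun; first exact: measurable_set_time.
  exact: measurable_cst.
have := half_plane_time_ae sa av d0 d1.
apply: (@filterS _ _ (ae_filter_ringOfSetsType mu)) => w hw.
have cM : (m%:R * L) @[m --> \oo] --> +oo%R.
  apply/cvgryPge => A; have := nbhs_infty_gtr (A / L).
  by apply: filterS => m; rewrite ltr_pdivrMr// => /ltW.
have hm : \forall m \near \oo,
    (1 - d) * (m%:R * L) <= set_time w 0 (half_plane a (m%:R * L)) := cM _ hw.
by apply: filterS hm => m hm; apply/negP; rewrite -leNgt.
Qed.

(** The starting point moves with [M], so stationarity is applied to the probability of each event
    and not to the almost sure limit. *)
Lemma passage_time_mu (p q : nat -> Z2) v (c rho rho' e : R) :
  (forall M, `|emb (q M - p M) - M%:R *: v| <= c) -> 0 < rho -> rho < rho' ->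
  B (rho^-1 *: v) -> 0 < e ->
  \forall M \near \oo,
    (mu [set w : cspace | (M%:R * rho' < passage_time w (p M) (q M))%R] <= e%:E)%E.
Proof.
move=> hpq rho0 rho1 Bv e0.
have mP M : measurable [set w : cspace | M%:R * rho' < passage_time w 0 (q M - p M)].
  apply: measurable_lt_fun; first exact: measurable_cst.
  exact: measurable_passage_time.
have := @ae_eventually_mu _ cspace R mu
  (fun M => [set w | M%:R * rho' < passage_time w 0 (q M - p M)]) e mP.
have ae := passage_time_ae hpq rho0 rho1 Bv.
case=> //.
  move: ae; apply: (@filterS _ _ (ae_filter_ringOfSetsType mu)) => w.
  by apply: filterS => M hM; apply/negP; rewrite -leNgt.
move=> N _ hN; exists N => // M NM.
rewrite (_ : [set _ | _] = [set w |
  [set w : cspace | M%:R * rho' < passage_time w 0 (q M - p M)] (lattice_act (translation (p M)) w)]); first by rewrite mu_translation//; exact: hN.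
by apply/seteqP; split => w /=; rewrite passage_time_translation add0r subrK.
Qed.

(** * Truncation by second moments and mean hitting times *)

Section Moments.
Variable K : R.
Hypotheses (K0 : 0 <= K) (EK : forall e, (\int[mu]_w (((w e)%:num ^+ 2)%:E) <= K%:E)%E).

Lemma measurable_edge_sqr (e : edge) (c : R) :
  measurable_fun [set: cspace] (fun w => ((w e)%:num ^+ 2 * c)%:E).
Proof.
apply/measurable_EFinP; apply: measurable_funM; last exact: measurable_cst.
by apply: measurable_funX; exact: measurable_edge.
Qed.

(** Each edge time is at most [lam], or else at most its square divided by [lam]. *)
Lemma path_time_le_truncated (w : config R) x p (lam : R) : 0 < lam ->
  path_time w x p <= \sum_(e <- pairmap edge_of x p) ((w e)%:num ^+ 2 / lam + lam).
Proof.
move=> lam0; apply: ler_sum => e _.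
have [h|h] := leP (w e)%:num lam; first by rewrite ler_wpDl// divr_ge0 ?sqr_ge0// ltW.
rewrite ler_wpDr ?(ltW lam0)// ler_pdivlMr// expr2 ler_wpM2l//.
exact: ltW.
Qed.

(** A form of uniform integrability: taking [lam] large and then [q] small makes the cost per edge
    of a rare event [A] as small as desired. *)
Lemma integral_truncated (es : seq edge) (lam q : R) (A : set cspace) : 0 < lam ->
  measurable A -> (mu A <= q%:E)%E ->
  (\int[mu]_w (\sum_(e <- es) ((w e)%:num ^+ 2 / lam + lam * \1_A w))%:E <=
   ((size es)%:R * (K / lam + lam * q))%:E)%E.
Proof.
move=> lam0 mA qA.
under eq_integral do rewrite -sumEFin.
have mi : measurable_fun [set: cspace] (fun w => (lam * \1_A w)%:E).
  apply/measurable_EFinP; apply: measurable_funM; first exact: measurable_cst.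
  exact: measurable_indic.
rewrite ge0_integral_sum//; last 2 first.
- move=> e; under eq_fun do rewrite EFinD.
  by apply: emeasurable_funD => //; exact: measurable_edge_sqr.
- move=> e w _; rewrite lee_fin addr_ge0 ?divr_ge0 ?sqr_ge0 ?mulr_ge0// ltW//.
have each e : (\int[mu]_w ((w e)%:num ^+ 2 / lam + lam * \1_A w)%:E <=
    (K / lam + lam * q)%:E)%E.
  under eq_integral do rewrite EFinD.
  rewrite ge0_integralD//; last 3 first.
  - by move=> w _; rewrite lee_fin divr_ge0 ?sqr_ge0// ltW.
  - exact: measurable_edge_sqr.
  - by move=> w _; rewrite lee_fin mulr_ge0// ltW.
  rewrite EFinD; apply: leeD.
    under eq_integral do rewrite mulrC EFinM.
    rewrite ge0_integralZl//; last 2 first.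
    - apply/measurable_EFinP; apply: measurable_funX; exact: measurable_edge.
    - by rewrite lee_fin invr_ge0 ltW.
    by rewrite mulrC EFinM lee_wpmul2l// lee_fin invr_ge0 ltW.
  under eq_integral do rewrite EFinM.
  rewrite ge0_integralZl//; last 2 first.
  - by apply/measurable_EFinP; exact: measurable_indic.
  - by rewrite lee_fin ltW.
  by rewrite integral_indic// setIT EFinM lee_wpmul2l// lee_fin ltW.
apply: (@le_trans _ _ (\sum_(e <- es) (K / lam + lam * q)%:E)%E); first exact: lee_sum.
by rewrite sumEFin big_const_seq count_predT iter_addr_0 mulr_natl.
Qed.

Lemma integral_set_time_lty x (A : set Z2) : A !=set0 ->
  (\int[mu]_w (set_time w x A)%:E < +oo)%E.
Proof.
move=> [y Ay]; have [p [pp pl _]] := lattice_path x y.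
pose Z (w : cspace) := \sum_(e <- pairmap edge_of x p)
  ((w e)%:num ^+ 2 / 1 + 1 * \1_[set: cspace] w).
have h : (\int[mu]_w (Z w)%:E < +oo)%E.
  have le1 : (mu [set: cspace] <= 1%:E)%E by rewrite probability_setT.
  exact: le_lt_trans (integral_truncated _ ltr01 measurableT le1) (ltry _).
apply: le_lt_trans h; apply: ge0_le_integral => //.
- by move=> w _; rewrite lee_fin set_time_ge0.
- by apply/measurable_EFinP; exact: measurable_set_time.
- apply/measurable_EFinP; apply: measurable_sum => e.
  apply: measurable_funD; first by apply/measurable_EFinP; exact: measurable_edge_sqr.
  by apply: measurable_funM; [exact: measurable_cst|exact: measurable_indic].
move=> w _; rewrite lee_fin /Z.
apply: (@le_trans _ _ (path_time w x p)); first by apply: set_time_le; rewrite ?pl.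
apply: le_trans (path_time_le_truncated w x p ltr01) _.
by apply: ler_sum => e _; rewrite indicT mul1r.
Qed.

Definition mean_time a s : R := fine (\int[mu]_w (set_time w 0 (half_plane a s))%:E).

(** By translation, the mean from [x] depends only on the height of the half plane above [x]. *)
Lemma integral_half_plane a v s x : dotp a v = 1 ->
  (\int[mu]_w (set_time w x (half_plane a s))%:E =
   (mean_time a (s - dotp a (emb x)))%:E)%E.
Proof.
move=> av; rewrite /mean_time fineK; last first.
  rewrite ge0_fin_numE; first by apply: integral_set_time_lty; exact: half_plane_neq0 av.
  by apply: integral_ge0 => w _; rewrite lee_fin set_time_ge0.
rewrite -(@integral_translation _ mu inv_mu x
  (fun w => (set_time w 0 (half_plane a (s - dotp a (emb x))))%:E)).
- apply: eq_integral => w _; rewrite set_time_translation add0r; congr (_%:E).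
  congr set_time; apply/seteqP; split => z; rewrite /half_plane /=;
  by rewrite embB dotpB lerD2r.
- by apply/measurable_EFinP; exact: measurable_set_time.
- by move=> w; rewrite lee_fin set_time_ge0.
Qed.

(** The time is at least (1 - d/2) s off an event of probability at most d/2, and (1 - d/2)^2 >= 1 -
    d. *)
Lemma mean_time_ge a v (L d : R) : supports B a -> dotp a v = 1 -> 0 < L ->
  0 < d -> d < 1 ->
  \forall m \near \oo, (1 - d) * (m%:R * L) <= mean_time a (m%:R * L).
Proof.
move=> sa av L0 d0 d1.
have d20 : 0 < d / 2 by lra.
have d21 : d / 2 < 1 by lra.
have := half_plane_time_mu sa av L0 d20 d21.
apply: filterS => m; set s := m%:R * L.
set E := [set w | _] => hE.
have s0 : 0 <= s by rewrite mulr_ge0// ltW.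
have mE : measurable E.
  apply: measurable_lt_fun; first exact: measurable_set_time.
  exact: measurable_cst.
have h : ((((1 - d / 2) * s)%:E * mu (~` E)) <= (mean_time a s)%:E)%E.
  have -> : mean_time a s = mean_time a (s - dotp a (emb 0)).
    by rewrite /dotp !mxE /= !mulr0 addr0 subr0.
  rewrite -(integral_half_plane _ _ av).
  rewrite -[in X in (X <= _)%E](setIT (~` E)) -integral_indic//; last exact: measurableC.
  rewrite -ge0_integralZl//; last 2 first.
  - by apply/measurable_EFinP; apply: measurable_indic; exact: measurableC.
  - by rewrite lee_fin mulr_ge0//; lra.
  apply: ge0_le_integral => //.
  - by move=> w _; rewrite -EFinM lee_fin !mulr_ge0//; lra.
  - apply: measurable_funeM; apply/measurable_EFinP; apply: measurable_indic.
    exact: measurableC.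
  - by apply/measurable_EFinP; exact: measurable_set_time.
  move=> w _; rewrite -EFinM lee_fin indicE.
  have [wE|wE] := boolP (w \in ~` E); last by rewrite mulr0 set_time_ge0.
  by rewrite mulr1 leNgt; move: wE; rewrite inE /E /= => /negP.
have : ((1 - d / 2)%:E <= mu (~` E))%E.
  by rewrite probability_setC// EFinB leeB.
move=> h2.
rewrite -lee_fin; apply: le_trans h.
apply: (@le_trans _ _ (((1 - d / 2) * s)%:E * (1 - d / 2)%:E)%E).
  rewrite -EFinM lee_fin.
  have : 0 <= d * d * s by rewrite !mulr_ge0// ltW.
  by lra.
by rewrite lee_wpmul2l// lee_fin mulr_ge0//; lra.
Qed.

(* The difference of the two hitting times is at most the passage time from [y]
   to [x]; if the mean of the difference is close to an upper bound [U] of this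
   passage time, then by Markov's inequality so is the difference. *)
Lemma hitting_difference_mu a v x y p (s D U eta lam q : R)
    (H := half_plane a (s + dotp a (emb x))) :
  dotp a v = 1 -> path nn_adjacent y p -> last y p = x ->
  0 < lam -> 0 <= U -> 0 < eta -> 
  (mu [set w : cspace | (U < passage_time w y x)%R] <= q%:E)%E ->
  D <= mean_time a (s + (dotp a (emb x) - dotp a (emb y))) - mean_time a s ->
  (mu [set w : cspace | (set_time w y H - set_time w x H <= U - eta)%R] <=
    ((U - D + (size p)%:R * (K / lam + lam * q)) / eta)%:E)%E.
Proof.
move=> av pp pl lam0 U0 eta0 hq hD.
set A := [set w : cspace | (U < _)%R] in hq.
set F := [set w : cspace | _].
have mA : measurable A.
  by apply: measurable_lt_fun; [exact: measurable_cst|exact: measurable_passage_time].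
have mT z : measurable_fun [set: cspace] (fun w => set_time w z H).
  exact: measurable_set_time.
have mF : measurable F by apply: measurable_le_cst; apply: measurable_funB.
have H0 : H !=set0 by exact: half_plane_neq0 av.
set es := pairmap edge_of y p.
(* On [A], [Z] dominates the time of the path [p], while its mean stays small. *)
pose Z (w : cspace) := \sum_(e <- es) ((w e)%:num ^+ 2 / lam + lam * \1_A w).
have mZ : measurable_fun [set: cspace] Z.
  apply: measurable_sum => e; apply: measurable_funD.
    by apply/measurable_EFinP; exact: measurable_edge_sqr.
  by apply: measurable_funM; [exact: measurable_cst|exact: measurable_indic].
have Z0 w : 0 <= Z w.
  by apply: sumr_ge0 => e _; rewrite addr_ge0 ?divr_ge0 ?sqr_ge0 ?mulr_ge0// ltW.
(* On [F] this is the definition of [F]. Off [F] it is the triangle inequality, the passage time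
   being bounded by [U] outside [A] and by [Z] on [A]. Without subtractions, both sides are
   nonnegative and integrate term by term. *)
have pw w : set_time w y H + eta * \1_F w <= U + Z w + set_time w x H.
  rewrite indicE; have [/set_mem|wF] := boolP (w \in F).
    by rewrite /F /= mulr1; have := Z0 w; lra.
  rewrite mulr0 addr0; apply: le_trans (set_time_triangle w y x H0) _.
  rewrite lerD2r.
  have [h|h] := leP (passage_time w y x) U; first by rewrite ler_wpDr.
  have tp : passage_time w y x <= path_time w y p.
    by rewrite passage_timeE; exact: set_time_le.
  rewrite ler_wpDl//; apply: le_trans tp _.
  apply: le_trans (path_time_le_truncated w y p lam0) _.
  apply: ler_sum => e _; rewrite indicE.
  by have /mem_set -> : A w by []; rewrite mulr1.
have int_le : (\int[mu]_w (set_time w y H + eta * \1_F w)%:E <=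
    \int[mu]_w (U + Z w + set_time w x H)%:E)%E.
  apply: ge0_le_integral => //.
  - by move=> w _; rewrite lee_fin addr_ge0 ?set_time_ge0// mulr_ge0// ltW.
  - apply/measurable_EFinP; apply: measurable_funD => //.
    by apply: measurable_funM; [exact: measurable_cst|exact: measurable_indic].
  - apply/measurable_EFinP; apply: measurable_funD => //.
    by apply: measurable_funD => //; exact: measurable_cst.
  - by move=> w _; rewrite lee_fin.
have EL : (\int[mu]_w (set_time w y H + eta * \1_F w)%:E =
    (mean_time a (s + (dotp a (emb x) - dotp a (emb y))))%:E + eta%:E * mu F)%E.
  under eq_integral do rewrite EFinD EFinM.
  rewrite ge0_integralD//; last 4 first.
  - by move=> w _; rewrite lee_fin set_time_ge0.
  - exact/measurable_EFinP.
  - by move=> w _; rewrite -EFinM lee_fin mulr_ge0// ltW.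
  - by apply: measurable_funeM; apply/measurable_EFinP; exact: measurable_indic.
  rewrite (integral_half_plane _ _ av) -addrA ge0_integralZl//; last 2 first.
  - by apply/measurable_EFinP; exact: measurable_indic.
  - by rewrite lee_fin ltW.
  by rewrite integral_indic// setIT.
have ER : (\int[mu]_w (U + Z w + set_time w x H)%:E <=
    (U + (size p)%:R * (K / lam + lam * q) + mean_time a s)%:E)%E.
  under eq_integral do rewrite EFinD.
  rewrite ge0_integralD//; last 4 first.
  - by move=> w _; rewrite lee_fin addr_ge0.
  - apply/measurable_EFinP; apply: measurable_funD => //; exact: measurable_cst.
  - by move=> w _; rewrite lee_fin set_time_ge0.
  - exact/measurable_EFinP.
  rewrite (integral_half_plane _ _ av) addrK [leRHS]EFinD leeD2r//.
  under eq_integral do rewrite EFinD.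
  rewrite ge0_integralD//; last 2 first.
  - by move=> w _; rewrite lee_fin.
  - exact/measurable_EFinP.
  rewrite integral_cst// EFinD; apply: leeD.
    by rewrite -[leRHS]mule1 lee_wpmul2l ?lee_fin// probability_le1.
  by have := integral_truncated es lam0 mA hq; rewrite size_pairmap.
have fF : mu F \is a fin_num by exact: fin_num_measure.
move: (le_trans int_le ER); rewrite EL -(fineK fF) -EFinM -EFinD !lee_fin.
by rewrite ler_pdivlMr// mulrC; lra.
Qed.

(* Ties count as beaten. *)
Definition beaten k (xs : 'I_k -> Z2) (i : 'I_k) a s : set cspace :=
  [set w | exists2 j, j != i &
    set_time w (xs j) (half_plane a s) <= set_time w (xs i) (half_plane a s)].

Lemma measurable_beaten k (xs : 'I_k -> Z2) i a s : measurable (beaten xs i a s).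
Proof.
set H := half_plane a s.
rewrite (_ : beaten _ _ _ _ = \bigcup_(j in [set j | j != i])
    ~` [set w : cspace | set_time w (xs i) H < set_time w (xs j) H]).
  apply: fin_bigcup_measurable; first exact: finite_finset.
  move=> j _; apply: measurableC.
  by apply: measurable_lt_fun; exact: measurable_set_time.
apply/seteqP; split => w [j /= ji hj]; exists j => //=; first by apply/negP; rewrite -leNgt.
by rewrite leNgt; apply/negP.
Qed.

(** Write x_j for the site near M v_j, x for x_i and T for the time to the half plane. [F] is the
    event that T(-x) - T(x) falls short of 2 M by a multiple of M, and [G j] that tau(-x, x_j)
    exceeds M (rho + eta). Outside all of them [i] is not beaten. The budget is e / 2 for [F] and e
    / (2 k) for each [G j]. *)
Lemma site_mu k (v a : 'I_k -> 'rV[R]_2) (rho : R) (i : 'I_k) (e : R) :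
  (forall i, supports B (a i)) -> (forall i, dotp (a i) (v i) = 1) ->
  (forall i, B (v i)) -> 0 < rho -> rho < 2 ->
  (forall i j, i != j -> B (rho^-1 *: (v i + v j))) -> 0 < e ->
  \forall M \near \oo, exists2 L : R, 0 < L &
    forall m0, exists2 m, (m0 <= m)%N &
    (mu (beaten (fun j => lattice_point (M%:R *: v j)) i (a i)
           (m%:R * L + dotp (a i) (emb (lattice_point (M%:R *: v i)))))
       <= e%:E)%E.
Proof.
move=> sa av Bv rho0 rho2 Brho e0.
(* Half of the gap, so that rho + eta = 2 - eta. *)
pose eta := (2 - rho) / 2; have eta0 : 0 < eta by rewrite /eta; lra.
(* The errors in the bound for [F] add up to at most 8 d M and must not exceed e eta M / 2, hence
   the 16; the bound 1/4 keeps 1 - 2 d nonnegative. *)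
pose d := Num.min (e * eta / 16) 4^-1.
have d0 : 0 < d by rewrite lt_min; apply/andP; split; rewrite ?invr_gt0// divr_gt0// mulr_gt0.
have d1 : d <= e * eta / 16 by rewrite ge_min lexx.
have d2 : d <= 4^-1 by rewrite ge_min lexx orbT.
(* [c1] bounds the rounding error seen by [a i]; c2 M will bound the length of a path from -x to
   x. *)
pose c1 := (`|a i 0 0| + `|a i 0 1|) * 2^-1.
have c10 : 0 <= c1 by rewrite mulr_ge0 ?addr_ge0.
pose c2 := 4 * `|v i| + 2; have c20 : 0 < c2 by rewrite ltr_wpDl ?mulr_ge0.
(* [lam] makes K / lam at most d / c2 and [q] makes lam q equal to d / c2, so truncation costs at
   most 2 d / c2 per edge. *)
pose lam := c2 * K / d + 1.
have lam0 : 0 < lam by rewrite ltr_wpDl// divr_ge0 ?mulr_ge0// ltW.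
pose q := d / (c2 * lam); have q0 : 0 < q by rewrite divr_gt0// mulr_gt0.
have k0 : 0 < k%:R :> R by rewrite ltr0n (leq_trans _ (ltn_ord i)).
pose X M j := lattice_point (M%:R *: v j).
have XE M j : `|emb (X M j) - M%:R *: v j| <= 2^-1 by exact: emb_lattice_point.
have XXE M j : `|emb (X M j - - X M i) - M%:R *: (v i + v j)| <= 1.
  rewrite opprK embD scalerDr.
  have -> : emb (X M j) + emb (X M i) - (M%:R *: v i + M%:R *: v j) =
     (emb (X M j) - M%:R *: v j) + (emb (X M i) - M%:R *: v i).
    by rewrite addrACA -opprD [_ *: v i + _]addrC.
  by apply: le_trans (ler_normD _ _) _; have := XE M j; have := XE M i; lra.
have near1 : \forall M \near \oo, (mu [set w : cspace |
    (M%:R * (2 + d) < passage_time w (- X M i) (X M i))%R] <= q%:E)%E.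
  apply: (passage_time_mu (v := v i + v i) (c := 1) (rho := 2)) => //; last 2 first.
  - lra.
  - have -> // : 2^-1 *: (v i + v i) = v i by apply: rV2P; rewrite !mxE; field.
have near2 : \forall M \near \oo, forall j, j != i -> (mu [set w : cspace |
    (M%:R * (rho + eta) < passage_time w (- X M i) (X M j))%R] <= (e / (2 * k%:R))%:E)%E.
  apply: filter_forall => j; have [->|ji] := eqVneq j i.
    by apply: nearW.
  have rr : rho < rho + eta by rewrite ltrDl.
  have ij : i != j by rewrite eq_sym.
  have ee : 0 < e / (2 * k%:R) by rewrite divr_gt0// mulr_gt0.
  have [N _ hN] := passage_time_mu (XXE ^~ j) rho0 rr (Brho i j ij) ee.
  by exists N => // M NM _; exact: hN.
near=> M.
have M1 : 1 <= M%:R :> R by rewrite ler1n; near: M; exact: nbhs_infty_gt.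
(* Gives 2 c1 <= d M and, together with M >= 1, the positivity of the step [L]. *)
have MC : 2 * c1 / d + c1 <= M%:R.
  by near: M; have := nbhs_infty_gtr (2 * c1 / d + c1); apply: filterS => M /ltW.
have h1 : (mu [set w : cspace |
    (M%:R * (2 + d) < passage_time w (- X M i) (X M i))%R] <= q%:E)%E by near: M.
have h2 : forall j, j != i -> (mu [set w : cspace |
    (M%:R * (rho + eta) < passage_time w (- X M i) (X M j))%R] <=
    (e / (2 * k%:R))%:E)%E by near: M.
set x := X M i in h1 h2.
have ax : M%:R - c1 <= dotp (a i) (emb x).
  have := dotp_le_norm (a i) (emb x - M%:R *: v i).
  have : (`|a i 0 0| + `|a i 0 1|) * `|emb x - M%:R *: v i| <= c1.
    by apply: ler_wpM2l; [rewrite addr_ge0|exact: XE].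
  move=> g1 g2; have := le_trans g2 g1.
  by rewrite dotpB dotpZ av mulr1 ler_norml => /andP[+ _]; lra.
(* The heights of a half plane above -x and above x differ by [L]; with [L] as step of the
   progression, the difference of mean times is an increment. *)
pose L := dotp (a i) (emb x) - dotp (a i) (emb (- x)).
have LE : L = 2 * dotp (a i) (emb x).
  by rewrite /L embN /dotp !mxE; ring.
have c1d : 0 < 2 * c1 / d \/ c1 = 0.
  have [->|c1n] := eqVneq c1 0; [by right|left].
  by rewrite divr_gt0// mulr_gt0// lt_neqAle eq_sym c1n.
have L0 : 0 < L by rewrite LE; case: c1d; lra.
have L1 : 2 * M%:R - 2 * c1 <= L by rewrite LE; lra.
exists L => // m0.
have [p [pp pl ps]] := lattice_path (- x) x.
have psM : (size p)%:R <= c2 * M%:R :> R.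
  have -> : (size p)%:R = 2 * (`|x.1%:~R| + `|x.2%:~R|) :> R.
    rewrite -[LHS]/((size p)%:Z%:~R) ps /= !opprK !intrD !intr_norm !intrD.
    by rewrite -!mulr2n !normrMn; ring.
  have xj j : `|emb x 0 j| <= M%:R * `|v i| + 2^-1.
    have -> : emb x 0 j = (emb x - M%:R *: v i) 0 j + M%:R * v i 0 j by rewrite !mxE subrK.
    apply: le_trans (ler_normD _ _) _; rewrite addrC lerD//.
      by rewrite normrM ger0_norm// ler_wpM2l// coord_le_norm.
    exact: le_trans (coord_le_norm _ _) (XE M i).
  have := xj 0; have := xj 1; rewrite emb0E emb1E /c2.
  by have : 0 <= M%:R * `|v i| by []; lra.
have d_lt1 : d < 1 by lra.
have [m mm0 hm] :=
  increment_frequently L0 d0 (mean_time_ge (sa i) (av i) L0 d0 d_lt1) m0.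
have incr : (1 - 2 * d) * L <= mean_time (a i) (m%:R * L + L) - mean_time (a i) (m%:R * L).
  by have -> : m%:R * L + L = m.+1%:R * L by rewrite -natr1; ring.
exists m => //; rewrite -/(X M i) -/x.
set H := half_plane (a i) (m%:R * L + dotp (a i) (emb x)).
pose U := M%:R * (2 + d).
have U0 : 0 <= U by rewrite mulr_ge0//; lra.
have Meta0 : 0 < M%:R * eta by rewrite mulr_gt0//; lra.
have hF := hitting_difference_mu (av i) pp pl lam0 U0 Meta0 h1 incr.
rewrite -/H in hF; set F := [set w : cspace | _] in hF.
have mT z : measurable_fun [set: cspace] (fun w => set_time w z H).
  exact: measurable_set_time.
have mF : measurable F by apply: measurable_le_cst; apply: measurable_funB.
(* Empty at j = i, so that the union bound runs over all indices. *)
pose G j := if j != i then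
  [set w : cspace | M%:R * (rho + eta) < passage_time w (- x) (X M j)] else set0.
have mG j : measurable (G j).
  rewrite /G; case: ifP => // _; apply: measurable_lt_fun; first exact: measurable_cst.
  exact: measurable_passage_time.
have GE j : (mu (G j) <= (e / (2 * k%:R))%:E)%E.
  rewrite /G; case: ifP => [/h2//|_].
  by rewrite measure0 lee_fin divr_ge0 ?mulr_ge0// ltW.
have H0 : H !=set0 by exact: half_plane_neq0 (av i).
apply: (@le_trans _ _ (mu (F `|` \big[setU/set0]_j G j))).
  apply: le_measure; rewrite ?inE.
  - exact: measurable_beaten.
  - by apply: measurableU => //; apply: bigsetU_measurable => j _; exact: mG.
  (* If [j] beats [i] and tau(-x, x_j) <= M (rho + eta), the triangle inequality through x_j gives
     T(-x) - T(x) <= M (rho + eta) < U - M eta, so [w] is in [F]. *)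
  move=> w [j ji hj]; have [Fw|nF] := pselect (F w); first by left.
  right; rewrite (bigD1 j)//=; left; rewrite /G ji /=.
  rewrite ltNge; apply/negP => hpt.
  apply: nF; rewrite /F /=.
  have := set_time_triangle w (- x) (X M j) H0.
  have : 0 < M%:R * d by rewrite mulr_gt0//; lra.
  have -> : U - M%:R * eta = M%:R * (rho + eta) + M%:R * d by rewrite /U /eta; field.
  by move: hj; rewrite -/x; lra.
have GS := bigsetU_mu_le mG GE.
have mGS : measurable (\big[setU/set0]_j G j) by apply: bigsetU_measurable => j _; exact: mG.
apply: (le_trans (measureU2 _ mF mGS)).
rewrite (_ : e = e / 2 + k%:R * (e / (2 * k%:R))); last by field; rewrite gt_eqF.
rewrite EFinD; apply: leeD GS; apply: le_trans hF _; rewrite lee_fin.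
rewrite ler_pdivrMr//.
have hK : K / lam + lam * q <= 2 * d / c2.
  have -> : lam * q = d / c2 by rewrite /q; field; rewrite !gt_eqF.
  have : K / lam <= d / c2.
    rewrite ler_pdivrMr//; have -> : d / c2 * lam = K + d / c2.
      by rewrite /lam; field; rewrite !gt_eqF.
    by rewrite lerDl divr_ge0// ltW.
  by lra.
have hS : (size p)%:R * (K / lam + lam * q) <= 2 * d * M%:R.
  apply: (@le_trans _ _ ((c2 * M%:R) * (2 * d / c2))).
    apply: ler_pM => //.
    exact: addr_ge0 (divr_ge0 K0 (ltW lam0)) (mulr_ge0 (ltW lam0) (ltW q0)).
  by rewrite le_eqVlt; apply/orP; left; apply/eqP; field; rewrite gt_eqF.
have hD : (1 - 2 * d) * (2 * M%:R - 2 * c1) <= (1 - 2 * d) * L.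
  by rewrite ler_wpM2l//; lra.
have c1M : 2 * c1 <= d * M%:R.
  have : 2 * c1 / d <= M%:R by lra.
  by rewrite ler_pdivrMr// [_ * d]mulrC.
have dM : d * M%:R <= e * eta / 16 * M%:R by rewrite ler_wpM2r//; lra.
have dc : 0 <= d * c1 by rewrite mulr_ge0// ltW.
(* [U] exceeds (1 - 2 d) L by at most 5 d M + 2 c1, truncation adds 2 d M, and 2 c1 <= d M. *)
rewrite /U; lra.
Unshelve. all: by end_near. Qed.

End Moments.

End ShapeTheorem.

(** * Coexistence *)

Lemma infinite_unbounded (R : realDomainType) (T : choiceType) (A : set T) (f : T -> R) :
  (forall c, exists2 z, A z & c < f z) -> infinite_set A.
Proof.
move=> h /finite_fsetP[F AF]; have [z] := h (\big[Num.max/0]_(z <- F) f z).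
rewrite AF /= => zF; apply/negP; rewrite -leNgt.
by apply: le_bigmax_seq.
Qed.

(** Expresses infiniteness through countably many conditions, as measurability of coexistence
    requires. *)
Lemma infinite_pickle (T : countType) (A : set T) :
  infinite_set A <-> forall n, exists2 z, A z & (n <= choice.pickle z)%N.
Proof.
split => [iA n|h]; last first.
  apply: (@infinite_unbounded int _ _ (fun z => (choice.pickle z)%:Z)) => c.
  have [z Az hz] := h (absz c).+1; exists z => //; lia.
apply: contrapT => nh; apply: iA.
have sA : A `<=` [set z | (choice.pickle z < n)%N].
  by move=> z Az /=; rewrite ltnNge; apply/negP => hz; apply: nh; exists z.
apply: (sub_finite_set sA).
apply: (@sub_finite_set _ _ [set` pmap choice.unpickle (iota 0 n) : seq T]).
  move=> z /= zn; rewrite mem_pmap; apply/mapP; exists (choice.pickle z).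
    by rewrite mem_iota add0n.
  by rewrite choice.pickleK.
exact: finite_seq.
Qed.

Section Coexistence.
Context {R : realType} {k : nat}.
Variable xs : 'I_k -> Z2.
Notation cspace := (config_space R).
Implicit Types (w : config R) (i j : 'I_k) (z : Z2).

(** Once [t] exceeds the passage times from all sites to [z], the label no longer depends on [t]; at
    most one site is strictly first, so the choice made by [pick] is forced. *)
Lemma growth_limitP w z i : growth_limit xs w z = i.+1 <->
  forall j, j != i -> passage_time w (xs i) z < passage_time w (xs j) z.
Proof.
pose b i := [forall j, (j != i) ==> (passage_time w (xs i) z < passage_time w (xs j) z)].
have -> : growth_limit xs w z = if [pick i | b i] is Some i then i.+1 else 0%N.
  apply: lim_near_cst; first exact: discrete_hausdorff.
  have : \forall t \near +oo, forall j, passage_time w (xs j) z <= t.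
    by apply: filter_forall => j; apply: nbhs_pinfty_ge; exact: num_real.
  apply: filterS => t ht; rewrite /growth.
  by under eq_pick do rewrite ht /=.
split.
  case: pickP => // j bj [/val_inj <-] l lj.
  by move/forallP: bj => /(_ l); rewrite lj.
move=> h; have bi : b i by apply/forallP => j; apply/implyP; exact: h.
case: pickP => [j bj|/(_ i)]; last by rewrite bi.
have [->//|ij] := eqVneq i j.
have := h j; rewrite eq_sym ij => /(_ isT) lt_ij.
by move/forallP: bj => /(_ i); rewrite ij /= ltNge (ltW lt_ij).
Qed.

Lemma measurable_coexistence : measurable (coexistence xs : set cspace).
Proof.
have mW i z : measurable [set w : cspace | growth_limit xs w z = i.+1].
  rewrite (_ : [set _ | _] = \bigcap_(j in [set j | j != i])
      [set w : cspace | passage_time w (xs i) z < passage_time w (xs j) z]).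
    apply: fin_bigcap_measurable; first exact: finite_finset.
    by move=> j _; apply: measurable_lt_fun; exact: measurable_passage_time.
  by apply/seteqP; split => w /= /growth_limitP.
rewrite (_ : coexistence xs = \bigcap_(i in [set: 'I_k]) \bigcap_n
    \bigcup_z [set w : cspace | growth_limit xs w z = i.+1 /\ (n <= choice.pickle z)%N]).
  apply: fin_bigcap_measurable; first exact: finite_finset.
  move=> i _; apply: bigcapT_measurable => n.
  apply: countable_bigcupT_measurable => // z.
  have [nz|nz] := boolP (n <= choice.pickle z)%N.
    rewrite (_ : [set _ | _] = [set w : cspace | growth_limit xs w z = i.+1])//.
    by apply/seteqP; split => w /=; [case|].
  by rewrite (_ : [set _ | _] = set0)// -subset0 => w /= [].
apply/seteqP; split => w hw i; first move=> _ n _.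
  have /infinite_pickle/(_ n)[z] := hw i.
  by exists z.
by apply/infinite_pickle => n; have [z _ [hz nz]] := hw i I n I; exists z.
Qed.

(* If the half plane is reached first from [xs i], some site of it has label
   [i.+1]; the half planes escape to infinity, so there are infinitely many. *)
Lemma coexistence_of_not_beaten w (a v : 'I_k -> 'rV[R]_2) (L c : 'I_k -> R) :
  (forall i, dotp (a i) (v i) = 1) -> (forall i, 0 < L i) ->
  (forall i m0, exists2 m, (m0 <= m)%N & ~ beaten xs i (a i) (m%:R * L i + c i) w) ->
  coexistence xs w.
Proof.
move=> av L0 hw i; apply: (@infinite_unbounded R _ _ (fun z => dotp (a i) (emb z))) => d.
have [m0 _ hm0] := nbhs_infty_gtr ((d - c i) / L i).
have [m mm0 nb] := hw i m0.
have dm : d < m%:R * L i + c i by have := hm0 m mm0; rewrite /= ltr_pdivrMr//; lra.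
set s := _ + _ in nb dm; set H := half_plane (a i) s.
have H0 : H !=set0 by exact: half_plane_neq0 (av i).
(* The default, one more than the time of site [i], serves when there is no rival, that is for k =
   1. *)
pose t := \big[Num.min/set_time w (xs i) H + 1]_(j | j != i) set_time w (xs j) H.
have [|z Hz zt] := @set_time_reach _ w (xs i) H t H0.
  apply: lt_bigmin; first by rewrite ltrDl.
  by move=> j ji; rewrite ltNge; apply/negP => hj; apply: nb; exists j.
exists z; last exact: lt_le_trans dm Hz.
apply/growth_limitP => j ji; apply: (lt_le_trans zt).
apply: (@le_trans _ _ (set_time w (xs j) H)); last exact: set_time_sub.
by rewrite /t (bigD1 j)//= ge_min lexx.
Qed.

End Coexistence.

Theorem theorem1p6 (R : realType) (mu : config_measure R) (k : nat) (eps : R)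
    (hmu : good mu) (hk : (0 < k)%N) (hkS : (k%:R%:E <= Sides mu)%E)
    (heps : 0 < eps) :
  exists xs : 'I_k -> Z2, ((1 - eps)%:E < mu (coexistence xs))%E.
Proof.
have [[inv_mu _] _ _ mom [shB bdB]] := hmu.
set B := limit_shape mu in shB bdB.
have [clB _ cvB _ _] := shB.
have [r r0 Br] := limit_shape_ball shB.
have [v spv] := spread_exists clB cvB bdB r0 Br hkS.
have [rho [rho0 rho2 Brho]] := spread_dilate clB cvB r0 Br spv.
have bv := spv.1.
have /choice[a ha] : forall i, exists a, supports B a /\ dotp a (v i) = 1.
  by move=> i; have [a sa av] := supportB clB cvB r0 Br (bv i); exists a.
have sa i : supports B (a i) by have [] := ha i.
have av i : dotp (a i) (v i) = 1 by have [] := ha i.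
have Bv i : B (v i) by have /(boundaryE clB)[] := bv i.
have [K K0 EK] := edge_second_moment inv_mu mom.
have k0 : 0 < k%:R :> R by rewrite ltr0n.
(* The k exceptional events then have total probability at most eps / 2, which leaves a strict
   inequality. *)
pose e := eps / (2 * k%:R); have e0 : 0 < e by rewrite divr_gt0// mulr_gt0.
(* One scale [M] that suits all k sites at once. *)
have [M _ hM] : \forall M \near \oo, forall i, exists2 L : R, 0 < L &
    forall m0, exists2 m, (m0 <= m)%N &
    (mu (beaten (fun j => lattice_point (M%:R *: v j)) i (a i)
      (m%:R * L + dotp (a i) (emb (lattice_point (M%:R *: v i))))) <= e%:E)%E.
  by apply: filter_forall => i; exact: (site_mu shB inv_mu K0 EK i sa av Bv rho0 rho2 Brho e0).
have {}hM := hM M (leqnn M).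
pose xs j := lattice_point (M%:R *: v j); exists xs.
have /choice[L hL] : forall i, exists L : R, 0 < L /\
    forall m0, exists2 m, (m0 <= m)%N &
    (mu (beaten xs i (a i) (m%:R * L + dotp (a i) (emb (xs i)))) <= e%:E)%E.
  by move=> i; have [L L0 h] := hM i; exists L.
pose E i m := beaten xs i (a i) (m%:R * L i + dotp (a i) (emb (xs i))).
have mE i m : measurable (E i m) by exact: measurable_beaten.
(* The event that site [i] is beaten at all but finitely many levels of its progression. *)
pose D i := \bigcup_n \bigcap_(m in [set m | (n <= m)%N]) E i m.
have mD i : measurable (D i).
  apply: bigcupT_measurable => n; apply: bigcap_measurable => //; by exists n => /=.
have Dmu i : (mu (D i) <= e%:E)%E by apply: liminf_mu_le => //; have [] := hL i.
have mDS : measurable (\big[setU/set0]_i D i) by apply: bigsetU_measurable.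
apply: (@lt_le_trans _ _ (mu (~` \big[setU/set0]_i D i))).
  rewrite probability_setC//.
  have := bigsetU_mu_le mD Dmu.
  have -> : k%:R * e = eps / 2 by rewrite /e; field; rewrite gt_eqF.
  have fD : mu (\big[setU/set0]_i D i) \is a fin_num by exact: fin_num_measure.
  by rewrite -(fineK fD) -EFinB lte_fin lee_fin; lra.
apply: le_measure; rewrite ?inE; [exact: measurableC|exact: measurable_coexistence|].
move=> w hw.
apply: (@coexistence_of_not_beaten _ _ xs w a v L (fun i => dotp (a i) (emb (xs i)))) => //.
  by move=> i; have [] := hL i.
move=> i m0; apply: contrapT => h; apply: hw; rewrite (bigD1 i)//=; left.
exists m0 => // m mm0; apply: contrapT => nE; apply: h; by exists m.
Qed.
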